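(* Let $\mathcal{T}=(S,(\mathcal{B}_i,T_i,\beta_i)_{i\in I})$ be a Souslin and non-redundant $(S,(\mathcal{B}_i)_{i\in I})$-based type structure. If $\mathcal{T}$ is terminal, then $\mathcal{T}$ is complete.
   Context: All topological spaces are metrizable; products carry the product topology, subsets the subspace topology, $\Sigma_X$ is the Borel $\sigma$-algebra, $\Delta(X)$ is the space of Borel probability measures with the weak convergence topology. For a family $\mathcal{B}\subseteq\Sigma_X$ of non-empty Borel sets, a CPS on $(X,\Sigma_X,\mathcal{B})$ is an array $\mu=(\mu(\cdot|B))_{B\in\mathcal{B}}\in\Delta(X)^{\mathcal{B}}$ with $\mu(B|B)=1$ for all $B$ and $\mu(A|B)\mu(B|C)=\mu(A|C)$ whenever $A\in\Sigma_X$, $B,C\in\mathcal{B}$, $A\subseteq B\subseteq C$; $\Delta^{\mathcal{B}}(X)$ is the set of CPSs with the subspace topology of the product topology on $\Delta(X)^{\mathcal{B}}$. Convention: for $X\times Y$ and $\mathcal{B}\subseteq\Sigma_X$, $\Delta^{\mathcal{B}}(X\times Y)$ denotes CPSs w.r.t. $\{B\times Y:B\in\mathcal{B}\}$. For measurable $f:X\to Y$ with $\mathcal{B}_X=\{f^{-1}(B):B\in\mathcal{B}_Y\}$, $\overline{\mathcal{L}}_f(\mu)(E|B):=\mu(f^{-1}(E)|f^{-1}(B))$. A Souslin space is a continuous image of a complete separable metric space. Setting: $I=\{i,j\}$ two players; $S$ a metrizable Souslin space; $\mathcal{B}_i\subseteq\Sigma_S$ countable families of non-empty Borel sets. An $(S,(\mathcal{B}_i)_{i\in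 I})$-based type structure is $\mathcal{T}=(S,(\mathcal{B}_i,T_i,\beta_i)_{i\in I})$ with each $T_i$ metrizable and each $\beta_i:T_i\to\Delta^{\mathcal{B}_i}(S\times T_j)$ Borel measurable. $\mathcal{T}$ is Souslin if every $T_i$ is Souslin; complete if every $\beta_i$ is surjective. Canonical hierarchies: $\Theta_i^0:=S$, $H_i^1:=\Delta^{\mathcal{B}_i}(S)$; for $n\ge1$, $\Theta_i^n:=S\times H_j^n$, $\rho_i^{n-1,n}:\Theta_i^n\to\Theta_i^{n-1}$ the coordinate projection dropping the last belief (projection onto $S$ if $n=1$), $H_i^{n+1}:=\{((\mu_i^1,\dots,\mu_i^n),\mu_i^{n+1})\in H_i^n\times\Delta^{\mathcal{B}_i}(\Theta_i^n):\overline{\mathcal{L}}_{\rho_i^{n-1,n}}(\mu_i^{n+1})=\mu_i^n\}$; $H_i:=\{(\mu_i^1,\mu_i^2,\dots)\in\prod_{n\ge0}\Delta^{\mathcal{B}_i}(\Theta_i^n):\forall n\ge1,(\mu_i^1,\dots,\mu_i^n)\in H_i^n\}$. Hierarchy maps: $h_{-i}^0:S\times T_j\to S$ the projection; $h_i^1(t_i):=\overline{\mathcal{L}}_{h_{-i}^0}(\beta_i(t_i))$; for $n\ge1$, $h_{-i}^n:=(\mathrm{Id}_S,h_j^n)$, $h_i^{n+1}(t_i):=(h_i^n(t_i),\overline{\mathcal{L}}_{h_{-i}^n}(\beta_i(t_i)))$; $h_i(t_i):=(\overline{\mathcal{L}}_{h_{-i}^n}(\beta_i(t_i)))_{n\ge0}\in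 H_i$; for another structure $\mathcal{T}^*$ these are $h_i^*$. $\mathcal{T}$ is non-redundant if each $h_i:T_i\to H_i$ is injective. $\mathcal{T}$ is terminal if for every $(S,(\mathcal{B}_i)_{i\in I})$-based type structure $\mathcal{T}^*=(S,(\mathcal{B}_i,T_i^*,\beta_i^* )_{i\in I})$, every $i$ and every $t_i^*\in T_i^*$ there is $t_i\in T_i$ with $h_i^*(t_i^* )=h_i(t_i)$. *)

(* Defs.v *)
From HB Require Import structures.
From mathcomp Require Import all_boot all_order all_algebra.
From mathcomp Require Import all_classical all_reals all_analysis.
From mathcomp Require Import Rstruct Rstruct_topology.
From Stdlib Require Import Rdefinitions.

Unset Strict Implicit.
Unset Printing Implicit Defensive.

Import Order.TTheory GRing.Theory Num.Theory.
Local Open Scope classical_set_scope.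
Local Open Scope ring_scope.

Notation R := Rdefinitions.R.

Definition is_metric {P : Type} (d : P -> P -> R) : Prop :=
  [/\ forall x y, 0 <= d x y,
      forall x y, d x y = 0 <-> x = y,
      forall x y, d x y = d y x &
      forall x y z, d x z <= d x y + d y z].

Definition metric_open {P : Type} (d : P -> P -> R) (U : set P) : Prop :=
  forall x, U x -> exists2 e : R, 0 < e & [set y | d x y < e] `<=` U.

Definition metrizable (X : topologicalType) : Prop :=
  exists d : X -> X -> R, is_metric d /\ forall U : set X, open U <-> metric_open d U.

Definition metric_complete {P : Type} (d : P -> P -> R) : Prop :=
  forall u : nat -> P,
    (forall e : R, 0 < e -> exists N : nat, forall m n : nat, leq N m -> leq N n -> d (u m) (u n) < e) ->
    exists x, forall e : R, 0 < e -> exists N : nat, forall n : nat, leq N n -> d (u n) x < e.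

Definition metric_separable {P : Type} (d : P -> P -> R) : Prop :=
  exists D : set P, countable D /\ forall x (e : R), 0 < e -> exists2 y, D y & d x y < e.

Definition souslin (X : topologicalType) : Prop :=
  exists (P : Type) (d : P -> P -> R),
    [/\ is_metric d, metric_complete d, metric_separable d &
        exists f : P -> X,
          (forall U : set X, open U -> metric_open d (f @^-1` U)) /\
          (forall x : X, exists p, f p = x)].

(* Spaces given as a subset [dom] of a carrier type together with the       *)
(* family of (relatively) open subsets of [dom].                            *)

Record space := Space { car : Type ; dom : set car ; opens : set (set car) }.
Arguments dom : clear implicits.
Arguments opens : clear implicits.

Definition topsp (X : topologicalType) : space := @Space X setT open.

(* the topology on D generated by the subbasis G (subspace of the topology
   generated by G): U is open iff U is included in D and every point of U
   has a basic neighbourhood (finite intersection of members of G) whose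
   trace on D is included in U *)
Definition gen_top {T : Type} (D : set T) (G : set (set T)) : set (set T) :=
  [set U | U `<=` D /\
     forall x, U x -> exists (n : nat) (A : nat -> set T),
       (forall k, ltn k n -> G (A k) /\ A k x) /\
       (forall y, D y -> (forall k, ltn k n -> A k y) -> U y)].

Definition prod_space (X Y : space) : space :=
  @Space (car X * car Y) (dom X `*` dom Y)
    (gen_top (dom X `*` dom Y)
       [set W | exists U V, [/\ opens X U, opens Y V & W = U `*` V]]).

Definition sub_space (X : space) (A : set (car X)) : space :=
  @Space (car X) (A `&` dom X)
    [set W | exists U, opens X U /\ W = U `&` (A `&` dom X)].

Definition borelsets (X : space) : set (set (car X)) :=
  [set B | <<s dom X, opens X >> B /\ B `<=` dom X].

(* A Borel probability measure on X is represented by the set function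
   giving its values on Borel sets, normalised to 0 on non-Borel sets. *)
Definition is_prob (X : space) (mu : set (car X) -> \bar R) : Prop :=
  [/\ forall A, ~ borelsets X A -> mu A = 0%E,
      forall A, borelsets X A -> (0 <= mu A)%E,
      mu set0 = 0%E,
      mu (dom X) = 1%E &
      forall F : nat -> set (car X), (forall n, borelsets X (F n)) -> trivIset setT F ->
        (fun n => (\sum_(k < n) mu (F k))%E) @ \oo --> mu (\bigcup_k F k)].

(* auxiliary measurable type used only to apply MathComp's Lebesgue integral:
   [option (car X)] with the sigma-algebra generated by the open sets *)
Definition bor (X : space) : Type := option (car X).
HB.instance Definition _ (X : space) := gen_eqMixin (bor X).
HB.instance Definition _ (X : space) := gen_choiceMixin (bor X).
HB.instance Definition _ (X : space) := isPointed.Build (bor X) None.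

Section bor_measurable.
Variable X : space.
Definition bor_measurable : set (set (bor X)) :=
  <<s [set Some @` U | U in opens X] >>.
Lemma bor_measurable0 : bor_measurable set0.
Proof. exact: (@sigma_algebra0 (bor X) setT). Qed.
Lemma bor_measurableC (U : set (bor X)) :
  bor_measurable U -> bor_measurable (~` U).
Proof. exact: (@sigma_algebraC (bor X)). Qed.
Lemma bor_measurableU (F : (set (bor X))^nat) :
  (forall i, bor_measurable (F i)) -> bor_measurable (\bigcup_i F i).
Proof. exact: (@sigma_algebra_bigcup (bor X) setT). Qed.
End bor_measurable.

HB.instance Definition _ (X : space) :=
  @isMeasurable.Build default_measure_display (bor X) (bor_measurable X)
    (bor_measurable0 X) (@bor_measurableC X) (@bor_measurableU X).

Definition pint (X : space) (mu : set (car X) -> \bar R) (f : car X -> R) : \bar R :=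
  (\int[fun A : set (bor X) => mu (Some @^-1` A `&` dom X)]_(x in [set: bor X])
     (oapp f 0 x)%:E)%E.

Definition bcont (X : space) (f : car X -> R) : Prop :=
  (exists M : R, forall x, dom X x -> `|f x| <= M) /\
  (forall V : set R, open V -> opens X [set x | dom X x /\ V (f x)]).

(* Delta(X) with the topology of weak convergence: the coarsest topology
   making mu |-> \int f dmu continuous for every bounded continuous f *)
Definition Delta (X : space) : space :=
  @Space (set (car X) -> \bar R) (is_prob X)
    (gen_top (is_prob X)
       [set W | exists (f : car X -> R) (V : set R),
          [/\ bcont X f, open V & W = [set mu | V (fine (pint X mu f))]]]).

Definition is_cps (X : space) {J : Type} (c : J -> set (car X))
    (mu : J -> set (car X) -> \bar R) : Prop :=
  [/\ forall k, is_prob X (mu k),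
      forall k, mu k (c k) = 1%E &
      forall A k l, borelsets X A -> A `<=` c k -> c k `<=` c l ->
        (mu k A * mu l (c k))%E = mu l A].

Definition cps_space (X : space) {J : Type} (c : J -> set (car X)) : space :=
  @Space (J -> car (Delta X)) (is_cps X c)
    (gen_top (is_cps X c)
       [set W | exists k U, opens (Delta X) U /\ W = [set mu | U (mu k)]]).

(* image CPS: L_f(mu)(E|B) = mu(f^-1(E)|f^-1(B)) (B indexed by k) *)
Definition marg (X Y : space) {J : Type} (f : car Y -> car X)
    (mu : J -> set (car Y) -> \bar R) : J -> set (car X) -> \bar R :=
  fun k E => if `[< borelsets X E >] then mu k (f @^-1` E `&` dom Y) else 0%E.

(* Type structures and hierarchies.  Players: I = bool, the opponent of p   *)
(* is ~~ p.                                                                 *)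

Section TypeStructures.
Variable S : topologicalType.
Variable Bs : bool -> set (set S).

Definition Bidx (p : bool) := {B : set S | Bs p B}.

(* Delta^{B_p}(Y) where Y comes with a map pr : Y -> S; the conditioning
   event of B is {y in Y | pr y \in B} (i.e. B x Z when Y = S x Z) *)
Definition Cps (p : bool) (Y : space) (pr : car Y -> S) : space :=
  cps_space Y (fun B : Bidx p => [set y | dom Y y /\ proj1_sig B (pr y)]).

(* stage n of the canonical hierarchy:
   Th p = Theta_p^n, prS p = its projection to S,
   Hn p = H_p^{n+1}, lastb p = the last belief mu_p^{n+1} in Delta^{B_p}(Theta_p^n),
   rho p = rho_p^{n,n+1} : Theta_p^{n+1} = S x H_{-p}^{n+1} -> Theta_p^n *)
Record stage := Stage {
  Th : bool -> space ;
  prS : forall p, car (Th p) -> S ;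
  Hn : bool -> space ;
  lastb : forall p, car (Hn p) -> car (Cps p (Th p) (prS p)) ;
  rho : forall p, S * car (Hn (~~ p)) -> car (Th p) }.
Arguments prS : clear implicits.
Arguments lastb : clear implicits.
Arguments rho : clear implicits.

Definition stage0 : stage :=
  @Stage (fun _ => topsp S) (fun _ => id) (fun p => Cps p (topsp S) id)
    (fun p x => x) (fun p sx => sx.1).

Definition next_stage (st : stage) : stage :=
  let Th' := fun p => prod_space (topsp S) (Hn st (~~ p)) in
  let prS' := fun p => (@fst S (car (Hn st (~~ p)))) in
  let Hn' := fun p =>
     sub_space (prod_space (Hn st p) (Cps p (Th' p) (prS' p)))
       [set x | marg (Th st p) (Th' p) (rho st p) x.2 = lastb st p x.1] in
  @Stage Th' prS' Hn' (fun p x => x.2) (fun p sx => (sx.1, sx.2.1)).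

Fixpoint stage_n (n : nat) : stage :=
  match n with 0 => stage0 | n'.+1 => next_stage (stage_n n') end.

(* Theta_p^n and H_p^{n+1} *)
Definition Theta (n : nat) (p : bool) : space := Th (stage_n n) p.
Definition Hlev (n : nat) (p : bool) : space := Hn (stage_n n) p.

Record tstruct := TStruct {
  Ty : bool -> topologicalType ;
  beta : forall p, Ty p -> car (Cps p (prod_space (topsp S) (topsp (Ty (~~ p))))
                                       (@fst S (Ty (~~ p)))) }.
Arguments beta : clear implicits.

Definition is_tstruct (T : tstruct) : Prop :=
  forall p, [/\ metrizable (Ty T p),
    forall t, dom (Cps p (prod_space (topsp S) (topsp (Ty T (~~ p))))
                         (@fst S (Ty T (~~ p)))) (beta T p t) &
    forall E, borelsets (Cps p (prod_space (topsp S) (topsp (Ty T (~~ p))))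
                         (@fst S (Ty T (~~ p)))) E ->
              borelsets (topsp (Ty T p)) (beta T p @^-1` E)].

Section Hierarchy.
Variable T : tstruct.

Let SxT (p : bool) : space := prod_space (topsp S) (topsp (Ty T (~~ p))).

(* hier n p = h_p^{n+1} : T_p -> H_p^{n+1} *)
Fixpoint hier (n : nat) : forall p, Ty T p -> car (Hn (stage_n n) p) :=
  match n return forall p, Ty T p -> car (Hn (stage_n n) p) with
  | 0 => fun p t =>
      marg (topsp S) (SxT p) (fun st : S * Ty T (~~ p) => st.1) (beta T p t)
  | n'.+1 => fun p t =>
      (hier n' p t,
       marg (Th (stage_n n'.+1) p) (SxT p)
         (fun st : S * Ty T (~~ p) => (st.1, hier n' (~~ p) st.2)) (beta T p t))
  end.

Definition hminus (n : nat) (p : bool) : S * Ty T (~~ p) -> car (Theta n p) :=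
  match n return S * Ty T (~~ p) -> car (Theta n p) with
  | 0 => fun st => st.1
  | n'.+1 => fun st => (st.1, hier n' (~~ p) st.2)
  end.

Definition hfull (p : bool) (t : Ty T p) :
    forall n, car (Cps p (Theta n p) (prS (stage_n n) p)) :=
  fun n => marg (Theta n p) (SxT p) (hminus n p) (beta T p t).

End Hierarchy.

Definition souslin_ts (T : tstruct) : Prop := forall p, souslin (Ty T p).

Definition complete_ts (T : tstruct) : Prop :=
  forall p mu, dom (Cps p (prod_space (topsp S) (topsp (Ty T (~~ p))))
                        (@fst S (Ty T (~~ p)))) mu ->
    exists t : Ty T p, beta T p t = mu.

Definition non_redundant (T : tstruct) : Prop := forall p, injective (hfull T p).

Definition terminal (T : tstruct) : Prop :=
  forall T' : tstruct, is_tstruct T' ->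
    forall p (t' : Ty T' p), exists t : Ty T p, hfull T' p t' = hfull T p t.

End TypeStructures.

Definition setting (S : topologicalType) (Bs : bool -> set (set S)) : Prop :=
  [/\ metrizable S, souslin S &
      forall p, countable (Bs p) /\
        forall B, Bs p B -> B !=set0 /\ borelsets (topsp S) B].

(* Main.v *)
From HB Require Import structures.
Require Import Defs.
From mathcomp Require Import all_boot all_order all_algebra.
From mathcomp Require Import all_classical all_reals all_analysis.
From mathcomp Require Import measurable_realfun Rstruct Rstruct_topology lra.

(* Given a CPS mu for player p, adjoin to T one new type of p with belief mu
   and apply terminality: some t in T_p has the same hierarchy, so beta(t) and
   mu have the same marginal on every Theta_p^n. Each Theta_p^n is separable
   and metrizable, hence countably many Borel sets of the Theta_p^n pull back
   to Borel sets of S x T_{-p} which, T being non-redundant, separate points.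
   As S x T_{-p} is Souslin, Blackwell's theorem shows that they generate its
   whole Borel sigma-algebra; so beta(t) and mu agree on a generating
   pi-system, and are equal. *)

Set Implicit Arguments.
Unset Strict Implicit.
Unset Printing Implicit Defensive.

Import Order.TTheory GRing.Theory Num.Theory.
Import numFieldNormedType.Exports.
Import HBNNSimple.
Local Open Scope classical_set_scope.
Local Open Scope ring_scope.

(** * Blackwell's theorem for images of closed subsets of the Baire space *)

(** Since each [beta] is only Borel, so are the hierarchy maps, and the image of the merely Souslin
    space S x T_{-p} under them need not be Borel. Inverting these maps is therefore not an option;
    Blackwell's theorem works inside the domain and asks only for countably many separating Borel
    sets. It is proved without a theory of analytic sets: a Borel set becomes clopen after a change
    of parametrization by the Baire space. A second obstacle is measurability. The weak topology
    speaks of integrals of continuous functions, whereas a marginal along a Borel map involves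
    integrals of Borel functions. Passing from the former to the latter is what makes the hierarchy
    maps Borel and the enlarged structure a type structure. The belief mu lives on the old space S x
    T_{-p}. All beliefs of the enlarged structure are pushed forward from the old spaces, and the
    opponent of p receives no new type, so old types keep their hierarchies and the hierarchy of the
    new type is computed with the maps of T itself. *)

Lemma finite_bound (P : nat -> nat -> Prop) (n : nat) :
  (forall k, (k < n)%N -> exists N, forall M, (N <= M)%N -> P k M) ->
  exists N, forall k, (k < n)%N -> P k N.
Proof.
elim: n => [|n IH] h; first by exists 0%N.
suff [N hN] : exists N, forall M, (N <= M)%N -> forall k, (k < n.+1)%N -> P k M.
  by exists N; exact: hN.
elim: n.+1 h => [|m IHm] h; first by exists 0%N.
have [|N hN] := IHm; first by move=> k km; apply: h; exact: ltnW.
have [N' hN'] := h m (ltnSn m).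
exists (maxn N N') => M; rewrite geq_max => /andP[h1 h2] k.
by rewrite ltnS leq_eqVlt => /orP[/eqP ->|km]; [exact: hN'|exact: hN].
Qed.

Section Representations.
Variables (X : Type) (phi : nat -> X -> R).

Definition agree (n : nat) (u v : nat -> nat) : Prop :=
  forall k, (k < n)%N -> u k = v k.

Lemma agree_le m n u v : (m <= n)%N -> agree n u v -> agree m u v.
Proof. by move=> mn h k km; apply: h; exact: leq_trans mn. Qed.

Definition baire_closed (K : set (nat -> nat)) : Prop :=
  forall u, (forall n, exists2 v, K v & agree n u v) -> K u.

(** A continuous parametrization of X by a closed subset of the Baire space; continuity is tested
    coordinate by coordinate, so it refers to the topology induced by [phi]. *)
Definition rep (K : set (nat -> nat)) (g : (nat -> nat) -> X) : Prop :=
  [/\ baire_closed K,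
      forall x, exists2 u, K u & g u = x &
      forall k u (e : R), K u -> 0 < e ->
        exists n, forall v, K v -> agree n u v -> `|phi k (g v) - phi k (g u)| < e].

(** The preimage of C under g is clopen in K; in [locally_open] it is only open. *)
Definition locally_constant K (g : (nat -> nat) -> X) (C : set X) : Prop :=
  forall u, K u -> exists n, forall v, K v -> agree n u v -> (C (g u) <-> C (g v)).

Definition locally_open K (g : (nat -> nat) -> X) (C : set X) : Prop :=
  forall u, K u -> C (g u) -> exists n, forall v, K v -> agree n u v -> C (g v).

(* A point of the new domain carries in front of u either 0, when g u is
   outside C, or m.+1, when the m-cylinder around u is mapped into C. *)
Lemma rep_open K g C : rep K g -> locally_open K g C ->
  exists K' g', rep K' g' /\ locally_constant K' g' C.
Proof.
move=> [Kcl Ksurj Kcont] Cop.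
pose tl (w : nat -> nat) k := w k.+1.
pose K' := [set w | K (tl w) /\
  if w 0%N is m.+1 then forall v, K v -> agree m (tl w) v -> C (g v)
  else ~ C (g (tl w))].
have tlA n u v : agree n.+1 u v -> agree n (tl u) (tl v).
  by move=> h k kn; exact: h.
exists K', (g \o tl); split; first split.
(* The leading digit is constant near a limit point. Openness excludes a limit with leading digit 0
   and image in C; for m.+1 the cylinder condition depends on finitely many digits only. *)
- move=> w hw.
  have Kw : K (tl w).
    apply: Kcl => n; have [v [Kv _] av] := hw n.+1.
    by exists (tl v) => //; exact: tlA.
  split => //; case w0 : (w 0%N) => [|m].
    move=> Cw; have [n hn] := Cop _ Kw Cw.
    have [v [Kv +] av] := hw n.+1.
    rewrite -(av 0%N) // w0; apply; apply: hn => //; exact: tlA.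
  have [v [Kv +] av] := hw m.+1.
  rewrite -(av 0%N) // w0 => h x Kx ax; apply: h => // k km.
  by rewrite -(tlA _ _ _ av) //; exact: ax.
- move=> x; have [u Ku gu] := Ksurj x.
  have [Cx|nCx] := pselect (C x).
    have [|m hm] := Cop u Ku; first by rewrite gu.
    by exists (fun k => if k is k'.+1 then u k' else m.+1).
  exists (fun k => if k is k'.+1 then u k' else 0%N) => //.
  by split => //=; rewrite /tl /= gu.
- move=> k u e [Ku _] e0; have [n hn] := Kcont k _ e Ku e0.
  by exists n.+1 => v [Kv _] av; apply: hn => //; exact: tlA.
- move=> u [Ku Cu]; exists 1%N => v [Kv Cv] /(_ 0%N isT) uv.
  rewrite -uv in Cv; case: (u 0%N) Cu Cv => [|m] Cu Cv; first by split.
  by split=> _; [apply: Cv|apply: Cu].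
Qed.

Hypothesis phi_inj : forall x y, (forall k, phi k x = phi k y) -> x = y.

(** The fibre product over X of all the parametrizations, with a sequence of sequences coded as one
    through [pickle]. It is closed because the maps are continuous and the [phi k] separate points.
    Every component computes the same point of X, so a set clopen along one of them is clopen along
    the product. *)
Lemma rep_countable_refinement (K : nat -> set (nat -> nat)) g :
  (forall n, rep (K n) (g n)) ->
  exists K' g', rep K' g' /\
    forall n C, locally_constant (K n) (g n) C -> locally_constant K' g' C.
Proof.
move=> H.
pose pr (n : nat) (w : nat -> nat) (m : nat) : nat := w (pickle (n, m)).
pose K' := [set w | forall n, K n (pr n w) /\ g n (pr n w) = g 0%N (pr 0%N w)].
have prA n M : exists N, forall w v, agree N w v -> agree M (pr n w) (pr n v).
  exists (\max_(m < M) (pickle (n, m : nat)).+1)%N => w v h m mM; apply: h.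
  exact: (@leq_bigmax _ (fun m : 'I_M => (pickle (n, m : nat)).+1) (Ordinal mM)).
exists K', (g 0%N \o pr 0%N); split; first split.
- move=> w hw n.
  have Kw m : K m (pr m w).
    have [Kcl _ _] := H m; apply: Kcl => M; have [N hN] := prA m M.
    by have [v /(_ m)[Kv _] av] := hw N; exists (pr m v) => //; exact: hN.
  split => //; apply: phi_inj => k; apply: contrapT => neq.
  (* Half the gap: both images at a nearby v of K' coincide and lie within e of the two distinct
     values, which is impossible. *)
  pose e := `|phi k (g n (pr n w)) - phi k (g 0%N (pr 0%N w))| / 2.
  have e0 : 0 < e by rewrite divr_gt0// normr_gt0 subr_eq0; exact/eqP.
  have [_ _ /(_ k _ _ (Kw n) e0) [N1 h1]] := H n.
  have [_ _ /(_ k _ _ (Kw 0%N) e0) [N2 h2]] := H 0%N.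
  have [M1 p1] := prA n N1; have [M2 p2] := prA 0%N N2.
  have [v Kv av] := hw (maxn M1 M2).
  have [Kv1 Kv2] := Kv n; have [Kv0 _] := Kv 0%N.
  have := h1 _ Kv1 (p1 _ _ (agree_le (leq_maxl M1 M2) av)).
  have := h2 _ Kv0 (p2 _ _ (agree_le (leq_maxr M1 M2) av)).
  rewrite Kv2 => a b.
  have := ler_distD (phi k (g 0%N (pr 0%N v)))
    (phi k (g n (pr n w))) (phi k (g 0%N (pr 0%N w))).
  rewrite (distrC (phi k (g n (pr n w))) (phi k (g 0%N (pr 0%N v)))).
  have : `|phi k (g n (pr n w)) - phi k (g 0%N (pr 0%N w))| = e + e.
    by rewrite /e -splitr.
  lra.
- move=> x.
  have /choice[u hu] : forall n, exists v, K n v /\ g n v = x.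
    by move=> n; have [_ /(_ x)[v ? ?] _] := H n; exists v.
  pose w c := if unpickle c is Some nm then u nm.1 nm.2 else 0%N.
  have prw n : pr n w = u n.
    by apply/funext => m; rewrite /pr /w pickleK.
  exists w => /=; last by rewrite prw; exact: (hu 0%N).2.
  by move=> n; rewrite !prw; split; [exact: (hu n).1|rewrite (hu n).2 (hu 0%N).2].
- move=> k w e Kw e0; have [_ _ c] := H 0%N.
  have [n hn] := c k _ e (Kw 0%N).1 e0; have [N hN] := prA 0%N n.
  by exists N => v Kv av; apply: hn; [exact: (Kv 0%N).1|exact: hN].
- move=> n C hC w Kw /=; have [M hM] := hC _ (Kw n).1; have [N hN] := prA n M.
  exists N => v Kv av; rewrite -(Kw n).2 -(Kv n).2.
  by apply: hM; [exact: (Kv n).1|exact: hN].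
Qed.

Definition phi_open (U : set X) : Prop := forall x, U x ->
  exists n (e : R), 0 < e /\
    forall y, (forall k, (k < n)%N -> `|phi k y - phi k x| < e) -> U y.

Lemma rep_phi_open K g U : rep K g -> phi_open U -> locally_open K g U.
Proof.
move=> [_ _ c] hU u Ku Uu; have [n [e [e0 hn]]] := hU _ Uu.
have [|N hN] := @finite_bound (fun k N => forall v, K v -> agree N u v ->
  `|phi k (g v) - phi k (g u)| < e) n.
  move=> k kn; have [N hN] := c k u e Ku e0.
  by exists N => M NM v Kv av; apply: hN => //; exact: agree_le av.
by exists N => v Kv av; apply: hn => k kn; exact: hN.
Qed.

(** The sets that are clopen along some parametrization form a sigma-algebra: for a countable union,
    refine until all members are clopen; the union is then open, and [rep_open] makes it clopen. *)
Lemma rep_borel (O : set (set X)) K0 g0 : O `<=` phi_open -> rep K0 g0 ->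
  forall C, <<s O >> C -> exists K g, rep K g /\ locally_constant K g C.
Proof.
move=> HO r0.
suff : <<s O >> `<=` [set C | exists K g, rep K g /\ locally_constant K g C] by [].
apply: smallest_sub; last first.
  by move=> U OU; apply: (rep_open r0); exact: (rep_phi_open r0 (HO _ OU)).
split.
- by exists K0, g0; split => // u Ku; exists 0%N.
- move=> A [K [g [r l]]]; exists K, g; split => // u Ku.
  have [n hn] := l u Ku; exists n => v Kv av; rewrite setTD.
  by split => h /(hn v Kv av).
- move=> A hA.
  have /choice[Kg hKg] : forall n, exists Kg : set (nat -> nat) * ((nat -> nat) -> X),
      rep Kg.1 Kg.2 /\ locally_constant Kg.1 Kg.2 (A n).
    by move=> n; have [K [g h]] := hA n; exists (K, g).
  have [K [g [r l]]] := rep_countable_refinement (fun n => (hKg n).1).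
  apply: (rep_open r) => u Ku [n _ An].
  have [N hN] := l n _ (hKg n).2 u Ku.
  by exists N => v Kv av; exists n => //; apply/(hN v Kv av).
Qed.

(* Lusin's separation argument, run on representations along which all the
   sets involved are clopen. *)
Lemma blackwell (O : set (set X)) K0 g0 (Cs : nat -> set X) :
  O `<=` phi_open -> rep K0 g0 ->
  (forall n, <<s O >> (Cs n)) ->
  (forall x y, (forall n, Cs n x <-> Cs n y) -> x = y) ->
  <<s O >> `<=` <<s range Cs >>.
Proof.
move=> HO r0 OC Csep E OE.
(* E is put in front of the separating sets, so that one refinement makes all of them clopen. *)
pose F n := if n is m.+1 then Cs m else E.
have /choice[Kg hKg] : forall n, exists Kg : set (nat -> nat) * ((nat -> nat) -> X),
    rep Kg.1 Kg.2 /\ locally_constant Kg.1 Kg.2 (F n).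
  move=> n; have [|K [g h]] := @rep_borel O K0 g0 HO r0 (F n); last by exists (K, g).
  by case: n => [|n]; [exact: OE|exact: OC].
have [K [g [[Kcl Ksurj Kcont] l]]] := rep_countable_refinement (fun n => (hKg n).1).
have lE : locally_constant K g E := l 0%N _ (hKg 0%N).2.
have lC n : locally_constant K g (Cs n) := l n.+1 _ (hKg n.+1).2.
have sC := smallest_sigma_algebra [set: X] (range Cs).
have [s0 sD sU] := sC.
have sN D : <<s range Cs >> D -> <<s range Cs >> (~` D).
  by move=> /sD; rewrite setTD.
have sI (D : nat -> set X) : (forall n, <<s range Cs >> (D n)) ->
    <<s range Cs >> (\bigcap_n D n).
  move=> h; rewrite -[X in <<s _ >> X]setCK setC_bigcap; apply: (sN).
  by apply: sU => n; exact: sN.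
pose sep (P Q : set (nat -> nat)) := exists D, [/\ <<s range Cs >> D,
  forall u, P u -> D (g u) & forall u, Q u -> ~ D (g u)].
pose A := [set u | K u /\ E (g u)]; pose B := [set u | K u /\ ~ E (g u)].
pose cyl (P : set (nat -> nat)) n u := [set v | P v /\ agree n u v].
have clA : baire_closed A.
  move=> u hu; have Ku : K u.
    by apply: Kcl => n; have [v [Kv _] av] := hu n; exists v.
  split => //; have [n hn] := lE u Ku; have [v [Kv Ev] av] := hu n.
  exact/(hn v Kv av).
have clB : baire_closed B.
  move=> u hu; have Ku : K u.
    by apply: Kcl => n; have [v [Kv _] av] := hu n; exists v.
  split => //; have [n hn] := lE u Ku; have [v [Kv Ev] av] := hu n.
  by move=> /(hn v Kv av).
(* A and B cover K and g is onto, so a set separating their images can only be E. *)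
suff [D [sDD DA DB]] : sep A B.
  suff -> : E = D by [].
  apply/seteqP; split=> x; have [u Ku <-] := Ksurj x; first by move=> ?; exact: DA.
  by move=> Dx; apply: contrapT => nE; apply: (DB u).
apply: contrapT => nsep.
pose T := ((nat -> nat) * (nat -> nat))%type.
pose bad n (s : T) := ~ sep (cyl A n s.1) (cyl B n s.2).
pose upd (u : nat -> nat) n m k := if (k < n)%N then u k else m.
have updA n (u : nat -> nat) m : agree n u (upd u n m) by move=> k kn; rewrite /upd kn.
have split_cyl P n u v : cyl P n u v -> cyl P n.+1 (upd u n (v n)) v.
  move=> [Pv av]; split => // k; rewrite ltnS leq_eqVlt /upd => /orP[/eqP ->|kn].
    by rewrite ltnn.
  by rewrite kn av.
(* Contrapositive: if all pairs of one-digit extensions are separated, by D(i, j) say, then the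
   union over i of the intersections over j separates the two cylinders themselves. *)
have step n (s : T) : exists s' : T, bad n s ->
    [/\ agree n s.1 s'.1, agree n s.2 s'.2 & bad n.+1 s'].
  apply: contrapT => hno.
  have hb : bad n s by apply: contrapT => nb; apply: hno; exists s.
  have hsep i j : sep (cyl A n.+1 (upd s.1 n i)) (cyl B n.+1 (upd s.2 n j)).
    apply: contrapT => ns; apply: hno; exists (upd s.1 n i, upd s.2 n j) => _.
    by split; [exact: updA|exact: updA|exact: ns].
  apply: hb.
  have /choice[D hD] : forall ij : nat * nat, exists D : set X,
      [/\ <<s range Cs >> D,
      forall u, cyl A n.+1 (upd s.1 n ij.1) u -> D (g u) &
      forall u, cyl B n.+1 (upd s.2 n ij.2) u -> ~ D (g u)].
    by move=> ij; exact: hsep.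
  exists (\bigcup_i \bigcap_j D (i, j)); split.
  - by apply: sU => i; apply: sI => j; have [] := hD (i, j).
  - move=> u hu; exists (u n) => // j _; have [_ h _] := hD (u n, j).
    by apply: h; exact: split_cyl.
  - move=> u hu [i _ /(_ (u n) I)]; have [_ _ h] := hD (i, u n).
    by apply: h; exact: split_cyl.
have /choice[f hf] : forall ns : nat * T, exists s' : T, bad ns.1 ns.2 ->
    [/\ agree ns.1 ns.2.1 s'.1, agree ns.1 ns.2.2 s'.2 & bad ns.1.+1 s'].
  by move=> ns; exact: step.
pose st := fix st n : T := if n is m.+1 then f (m, st m) else ((fun=> 0%N), (fun=> 0%N)).
have stb n : bad n (st n).
  elim: n => [|n IH] /=; last by have [] := hf (n, st n) IH.
  move=> [D [? hA hB]]; apply: nsep; exists D; split => // u hu.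
    by apply: hA; split.
  by apply: hB; split.
(* Digit k is settled from stage k.+1 on, so U and V are the limits of the two nested sequences of
   cylinders. *)
pose U k := (st k.+1).1 k; pose V k := (st k.+1).2 k.
have stS m n : (m <= n)%N -> agree m (st m).1 (st n).1 /\ agree m (st m).2 (st n).2.
  move=> mn; rewrite -(subnKC mn); elim: (n - m)%N => [|d [IH1 IH2]].
    by rewrite addn0.
  rewrite addnS; have [h1 h2 _] := hf ((m + d)%N, st (m + d)%N) (stb _).
  have md : (m <= m + d)%N by exact: leq_addr.
  split=> k km; [rewrite IH1//; apply: h1|rewrite IH2//; apply: h2];
    exact: leq_trans md.
have aU n : agree n U (st n).1 by move=> k kn; apply: (stS _ _ kn).1.
have aV n : agree n V (st n).2 by move=> k kn; apply: (stS _ _ kn).2.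
(* Otherwise some cylinder of A around U is empty, and the empty set separates it from anything; for
   V the full set plays this part. *)
have AU : A U.
  apply: clA => n; apply: contrapT => hno; apply: (stb n).
  exists set0; split; [exact: s0| |by move=> u _ []].
  move=> u [Au au]; case: hno; exists u; first exact: Au.
  by move=> k kn; rewrite (aU n) // au.
have BV : B V.
  apply: clB => n; apply: contrapT => hno; apply: (stb n).
  exists setT; split => //; first by have := sN _ s0; rewrite setC0.
  move=> u [Au au]; case: hno; exists u; first exact: Au.
  by move=> k kn; rewrite (aV n) // au.
(* E contains g U but not g V, so the two points differ and some [Cs n] tells them apart. Being
   clopen, it is constant on deep enough cylinders, so it or its complement separates a pair that
   was chosen inseparable. *)
have [n nC] : exists n, ~ (Cs n (g U) <-> Cs n (g V)).
  apply: contrapT => /forallNP h; case: (BV) => _; apply.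
  rewrite -(Csep (g U) (g V)); first exact: AU.2.
  by move=> n; apply: contrapT; exact: h.
have [N1 h1] := lC n _ AU.1; have [N2 h2] := lC n _ BV.1.
pose N := maxn N1 N2.
have hA u : cyl A N (st N).1 u -> Cs n (g U) <-> Cs n (g u).
  move=> [[Ku _] au]; apply: h1 => //; apply: (@agree_le N1 N); first exact: leq_maxl.
  by move=> k kN; rewrite (aU N)// au.
have hB u : cyl B N (st N).2 u -> Cs n (g V) <-> Cs n (g u).
  move=> [[Ku _] au]; apply: h2 => //; apply: (@agree_le N2 N); first exact: leq_maxr.
  by move=> k kN; rewrite (aV N)// au.
have sCn : <<s range Cs >> (Cs n) by apply: sub_gen_smallest; exists n.
apply: (stb N); have [CU|nCU] := pselect (Cs n (g U)).
  exists (Cs n); split => // u hu; first exact/(hA u hu).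
  by move=> /(hB u hu) CV; apply: nC.
exists (~` Cs n); split; first exact: sN.
  by move=> u hu /(hA u hu).
move=> u hu /= h; apply: (nC); split; first by move/nCU.
by move=> /(hB u hu) CV; case: (h CV).
Qed.

End Representations.

(** * Separable metrizable spaces through countable families of coordinates *)

Definition coord_nbhd {T : Type} (D : set T) (phi : nat -> T -> R) (x : T) (V : set T) : Prop :=
  exists n (e : R), 0 < e /\
    forall y, D y -> (forall k, (k < n)%N -> `|phi k y - phi k x| < e) -> V y.

(** A homeomorphic embedding of the space into the countable power of the reals, which stands for
    separable metrizability. In this form the property passes to products, subspaces and spaces of
    measures by exhibiting new sequences of functions, with no metric to build. *)
Definition coordinates (X : Defs.space) (phi : nat -> car X -> R) : Prop :=
  (forall U, opens X U <-> U `<=` dom X /\ forall x, U x -> coord_nbhd (dom X) phi x U) /\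
  (forall x y, dom X x -> dom X y -> (forall k, phi k x = phi k y) -> x = y).
Arguments coordinates : clear implicits.

Section Neighbourhoods.
Variables (T : Type) (D : set T).

Lemma coord_nbhd_fin phi x (V : nat -> set T) n :
  (forall k, (k < n)%N -> coord_nbhd D phi x (V k)) ->
  coord_nbhd D phi x [set y | forall k, (k < n)%N -> V k y].
Proof.
elim: n => [|n IH] h; first by exists 0%N, 1; split => // y _ _ k.
have [|n1 [e1 [e10 h1]]] := IH; first by move=> k kn; apply: h; exact: ltnW.
have [n2 [e2 [e20 h2]]] := h n (ltnSn n).
exists (maxn n1 n2), (Num.min e1 e2); split; first by rewrite lt_min e10.
move=> y Dy hy k; rewrite ltnS leq_eqVlt => /orP[/eqP ->|kn].
  apply: h2 => // j jn; have := hy j; rewrite leq_max jn orbT lt_min.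
  by move=> /(_ isT)/andP[].
apply: h1 kn => // j jn; have := hy j; rewrite leq_max jn lt_min.
by move=> /(_ isT)/andP[].
Qed.

Lemma coord_nbhd_sub phi x (V W : set T) : V `&` D `<=` W ->
  coord_nbhd D phi x V -> coord_nbhd D phi x W.
Proof.
by move=> VW [n [e [e0 h]]]; exists n, e; split => // y Dy hy; apply: VW; split=> //; exact: h.
Qed.

Definition gen_nbhd (G : set (set T)) (x : T) (V : set T) : Prop :=
  exists (n : nat) (A : nat -> set T),
    (forall k, ltn k n -> G (A k) /\ A k x) /\
    (forall y, D y -> (forall k, ltn k n -> A k y) -> V y).

Lemma gen_nbhd_fin G x (V : nat -> set T) n :
  (forall k, (k < n)%N -> gen_nbhd G x (V k)) ->
  gen_nbhd G x [set y | forall k, (k < n)%N -> V k y].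
Proof.
elim: n => [|n IH] h; first by exists 0%N, (fun=> setT); split.
have [|n1 [A1 [a1 h1]]] := IH; first by move=> k kn; apply: h; exact: ltnW.
have [n2 [A2 [a2 h2]]] := h n (ltnSn n).
exists (n1 + n2)%N, (fun j => if (j < n1)%N then A1 j else A2 (j - n1)%N); split.
  move=> k /= kn; case: ifPn => [kn1|]; first exact: a1.
  by rewrite -leqNgt => n1k; apply: a2 => /=; rewrite ltn_subLR.
move=> y Dy hy k; rewrite ltnS leq_eqVlt => /orP[/eqP ->|kn].
  apply: h2 => // j /= jn; have := hy (n1 + j)%N.
  by rewrite /= ltn_add2l jn ltnNge leq_addr /= addKn; exact.
apply: h1 kn => // j /= jn; have := hy j.
by rewrite /= jn; apply; exact: ltn_addr.
Qed.

(** Compares a generated topology with that of the coordinates on subbasic sets only; closure of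
    both notions of neighbourhood under finite intersections does the rest. *)
Lemma gen_topE G phi :
  (forall W x, G W -> D x -> W x -> coord_nbhd D phi x W) ->
  (forall k x (e : R), D x -> 0 < e -> gen_nbhd G x [set y | `|phi k y - phi k x| < e]) ->
  forall U, gen_top D G U <-> U `<=` D /\ forall x, U x -> coord_nbhd D phi x U.
Proof.
move=> hG hphi U; split=> -[UD h]; split => // x Ux.
  have [n [A [a1 a2]]] := h x Ux.
  have /coord_nbhd_fin : forall k, (k < n)%N -> coord_nbhd D phi x (A k).
    by move=> k kn; have [? ?] := a1 k kn; apply: hG => //; exact: UD.
  by apply: coord_nbhd_sub => y [hy Dy]; exact: a2.
have [n [e [e0 hn]]] := h x Ux.
have [m [A [a1 a2]]] := @gen_nbhd_fin G x _ n (fun k _ => hphi k x e (UD _ Ux) e0).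
by exists m, A; split => // y Dy hy; apply: hn => //; exact: a2.
Qed.

End Neighbourhoods.

Lemma coordinates_open_lt X phi k x (e : R) : coordinates X phi -> dom X x -> 0 < e ->
  opens X [set y | dom X y /\ `|phi k y - phi k x| < e].
Proof.
move=> [h _] Dx e0; apply/h; split; first by move=> y [].
move=> y [Dy hy]; exists k.+1, (e - `|phi k y - phi k x|); split; first by rewrite subr_gt0.
move=> z Dz /(_ k (ltnSn k)) hz; split => //.
have := ler_distD (phi k y) (phi k z) (phi k x); lra.
Qed.

Lemma coordinates_nbhd X phi x U : coordinates X phi -> opens X U -> U x ->
  coord_nbhd (dom X) phi x U.
Proof. by move=> [h _] /h[_]; exact. Qed.

Lemma coordinates_dom X phi U : coordinates X phi -> opens X U -> U `<=` dom X.
Proof. by move=> [h _] /h[]. Qed.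

Lemma coordinates_openT X phi : coordinates X phi -> opens X (dom X).
Proof. by move=> [h _]; apply/h; split=> // x _; exists 0%N, 1; split. Qed.

Definition prod_coord {S T : Type} (phi : nat -> S -> R) (psi : nat -> T -> R)
  (i : nat) (z : S * T) : R := if odd i then psi i./2 z.2 else phi i./2 z.1.

Lemma prod_coordinates X Y phi psi : coordinates X phi -> coordinates Y psi ->
  coordinates (prod_space X Y) (prod_coord phi psi).
Proof.
move=> cX cY; have eo k : prod_coord phi psi k.*2 = phi k \o fst.
  by apply/funext => z; rewrite /prod_coord odd_double doubleK.
have oo k : prod_coord phi psi k.*2.+1 = psi k \o snd.
  by apply/funext => z; rewrite /prod_coord /= odd_double /= uphalf_double.
split; last first.
  move=> [x y] [x' y'] [/= Dx Dy] [/= Dx' Dy'] h; congr (_, _).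
    by apply: cX.2 => // k; have := h k.*2; rewrite eo.
  by apply: cY.2 => // k; have := h k.*2.+1; rewrite oo.
apply: gen_topE.
  move=> _ [x y] [U [V [oU oV ->]]] [/= Dx Dy] [/= Ux Vy].
  have [n [e [e0 hn]]] := coordinates_nbhd cX oU Ux.
  have [m [d [d0 hm]]] := coordinates_nbhd cY oV Vy.
  exists (maxn n m).*2.+1, (Num.min e d); split; first by rewrite lt_min e0.
  move=> [x' y'] [/= Dx' Dy'] h; split => /=.
    apply: hn => // k kn; have := h k.*2; rewrite eo /= lt_min => /(_ _)/andP[] //.
    by rewrite ltnS leq_double leq_max (ltnW kn).
  apply: hm => // k km; have := h k.*2.+1; rewrite oo /= lt_min => /(_ _)/andP[] //.
  by rewrite ltnS ltn_double leq_max km orbT.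
move=> i [x y] e [/= Dx Dy] e0.
exists 1%N, (fun=> if odd i then dom X `*` [set y' | dom Y y' /\ `|psi i./2 y' - psi i./2 y| < e]
  else [set x' | dom X x' /\ `|phi i./2 x' - phi i./2 x| < e] `*` dom Y); split.
  move=> _ _; split.
    case: ifPn => _.
      exists (dom X), [set y' | dom Y y' /\ `|psi i./2 y' - psi i./2 y| < e]; split=> //.
        exact: (coordinates_openT cX).
      exact: (coordinates_open_lt _ cY).
    exists [set x' | dom X x' /\ `|phi i./2 x' - phi i./2 x| < e], (dom Y); split=> //.
      exact: (coordinates_open_lt _ cX).
    exact: (coordinates_openT cY).
  by case: ifPn => _; split => //=; split=> //; rewrite subrr normr0.
move=> [x' y'] [/= Dx' Dy'] /(_ 0%N isT); rewrite /prod_coord /=.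
by case: ifPn => _ [h1 h2]; [exact: h2.2|exact: h1.2].
Qed.

Lemma sub_coordinates X phi (A : set (car X)) : coordinates X phi ->
  coordinates (sub_space X A) phi.
Proof.
move=> cX; split; last by move=> x y [_ Dx] [_ Dy]; exact: cX.2.
move=> W; split.
  move=> [U [oU ->]]; split; first by move=> x [].
  move=> x [Ux [Ax Dx]]; have [n [e [e0 h]]] := coordinates_nbhd cX oU Ux.
  by exists n, e; split => // y [Ay Dy] hy; split => //; exact: h.
(* The ambient open set cutting out W: all points with a coordinate neighbourhood whose trace lies
   in W. A point with radius e has neighbours within e/2 that keep the radius e/2, whence
   openness. *)
move=> [WD h]; exists [set x | dom X x /\ coord_nbhd (A `&` dom X) phi x W]; split.
  apply/(cX.1 _); split; first by move=> x [].
  move=> x [Dx [n [e [e0 hn]]]]; exists n, (e/2); split; first by rewrite divr_gt0.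
  move=> y Dy hy; split => //; exists n, (e/2); split; first by rewrite divr_gt0.
  move=> z [Az Dz] hz; apply: hn => // k kn.
  have := ler_distD (phi k y) (phi k z) (phi k x).
  by have := hy k kn; have := hz k kn; lra.
apply/seteqP; split=> x.
  by move=> Wx; split; [split; [exact: (WD _ Wx).2|exact: h]|exact: WD].
move=> [[Dx [n [e [e0 hn]]]] Ax]; apply: hn => // k _.
by rewrite subrr normr0.
Qed.

(** Values in [option] allow the empty set to be enumerated too. *)
Lemma countable_enum (T : Type) (A : set T) : countable A ->
  exists c : nat -> option T, (forall x, A x -> exists n, c n = Some x) /\
    (forall n x, c n = Some x -> A x).
Proof.
move=> /countable_injP[f finj].
exists (fun n => if pselect (exists x, A x /\ f x = n) is left h
  then Some (projT1 (cid h)) else None).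
split=> [x Ax|n x].
  exists (f x); case: pselect => [h|[]]; last by exists x.
  case: cid => y /= [Ay fy]; congr Some; apply: finj => //; exact/mem_set.
by case: pselect => // h; case: cid => y /= [Ay _] [<-].
Qed.

(** The coordinates are the distances to the images f(p), for p in a countable dense subset of P;
    these images are dense in X because f is continuous and onto. *)
Lemma topsp_coordinates (X : topologicalType) : metrizable X -> souslin X ->
  exists phi, coordinates (topsp X) phi.
Proof.
move=> [d [[d0 dE dC dT] dO]] [P [dP [_ _ [D [cD dense]] [f [fc fs]]]]].
have [c [hc _]] := countable_enum cD.
pose phi k (x : X) : R := if c k is Some p then d (f p) x else 0.
have dxx x : d x x = 0 by apply/dE.
have near_pt x (e : R) : 0 < e -> exists k y, (forall z, phi k z = d y z) /\ d y x < e.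
  move=> e0; have ob : open [set y | d x y < e].
    apply/dO => y /= hy; exists (e - d x y); first by rewrite subr_gt0.
    by move=> z /= hz; have := dT x y z; lra.
  have [p fp] := fs x.
  have [|r r0 hr] := fc _ ob p; first by rewrite /= fp dxx.
  have [q Dq hq] := dense p r r0.
  have [k ck] := hc q Dq.
  exists k, (f q); split; first by move=> z; rewrite /phi ck.
  by rewrite dC; exact: hr.
exists phi; split; last first.
  move=> x y _ _ h; apply/dE/eqP; rewrite eq_le d0 andbT leNgt; apply/negP => dxy.
  have [|k [z [hz zx]]] := near_pt x (d x y / 2); first by rewrite divr_gt0.
  by have := h k; have := dT x z y; rewrite !hz (dC x z); lra.
move=> U; split.
  move=> /dO oU; split => // x Ux; have [e e0 he] := oU x Ux.
  have [|k [z [hz zx]]] := near_pt x (e / 3); first by rewrite divr_gt0.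
  exists k.+1, (e / 3); split; first by rewrite divr_gt0.
  move=> y _ /(_ k (ltnSn k)); rewrite !hz => h; apply: he => /=.
  have := dT x z y; rewrite (dC x z).
  by have := ler_norm (d z y - d z x); lra.
move=> [_ h]; apply/dO => x Ux; have [n [e [e0 hn]]] := h x Ux.
exists e => // y /= xy; apply: hn => // k _.
rewrite /phi; case: (c k) => [p|]; last by rewrite subrr normr0.
have := dT (f p) x y; have := dT (f p) y x; rewrite (dC y x) => h1 h2.
by apply/ltr_normlP; split; lra.
Qed.

(** * Borel sets and Borel maps *)

Lemma borelsets_sigma (X : Defs.space) : sigma_algebra (dom X) (borelsets X).
Proof.
have [s0 sD sU] := @smallest_sigma_algebra _ (dom X) (opens X).
split.
- by split.
- by move=> A [sA AD]; split; [exact: sD|move=> x []].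
- by move=> A hA; split; [apply: sU => n; exact: (hA n).1|move=> x [n _]; exact: (hA n).2].
Qed.

Lemma borelsetsU (X : Defs.space) (F : nat -> set (car X)) :
  (forall n, borelsets X (F n)) -> borelsets X (\bigcup_n F n).
Proof. by have [_ _] := borelsets_sigma X; exact. Qed.

Lemma borelsetsD (X : Defs.space) A : borelsets X A -> borelsets X (dom X `\` A).
Proof. by have [_ h _] := borelsets_sigma X; exact: h. Qed.

Lemma borelsets0 (X : Defs.space) : borelsets X set0.
Proof. by have [] := borelsets_sigma X. Qed.

Lemma borelsetsT (X : Defs.space) : borelsets X (dom X).
Proof. by have := borelsetsD (borelsets0 X); rewrite setD0. Qed.

Lemma borelsetsI (X : Defs.space) A B : borelsets X A -> borelsets X B -> borelsets X (A `&` B).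
Proof.
move=> hA hB.
have -> : A `&` B = dom X `\` \bigcup_n (if n == 0%N then dom X `\` A else dom X `\` B).
  apply/seteqP; split=> x.
    move=> [Ax Bx]; split; first exact: hA.2.
    by move=> [n _]; case: ifP => _ [].
  move=> [Dx h]; split; apply: contrapT => hx; apply: h.
    by exists 0%N.
  by exists 1%N.
apply: borelsetsD; apply: borelsetsU => n.
by case: ifP => _; exact: borelsetsD.
Qed.

Lemma borelsets_bigcup_count (X : Defs.space) (I : countType) (F : I -> set (car X)) :
  (forall i, borelsets X (F i)) -> borelsets X [set x | exists i, F i x].
Proof.
move=> h; have -> : [set x | exists i, F i x] =
    \bigcup_n (if unpickle n is Some i then F i else set0).
  apply/seteqP; split=> x.
    by move=> [i Fx]; exists (pickle i) => //; rewrite pickleK.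
  by move=> [n _]; case: (unpickle n) => // i Fi; exists i.
apply: borelsetsU => n; case: (unpickle n) => [i|]; [exact: h|exact: borelsets0].
Qed.

Lemma borelsets_min (X : Defs.space) (M : set (set (car X))) :
  sigma_algebra (dom X) M -> opens X `<=` M -> borelsets X `<=` M.
Proof. by move=> sM oM B [h _]; exact: (h M). Qed.

Lemma borelsets_open (X : Defs.space) phi U : coordinates X phi -> opens X U -> borelsets X U.
Proof.
by move=> cX oU; split; [exact: sub_gen_smallest|exact: (coordinates_dom cX)].
Qed.

Definition borel_map (X Y : Defs.space) (f : car X -> car Y) : Prop :=
  (forall x, dom X x -> dom Y (f x)) /\
  forall E, borelsets Y E -> borelsets X (f @^-1` E `&` dom X).

Definition borel_fun (X : Defs.space) (g : car X -> R) : Prop :=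
  forall V : set (measurableTypeR R), measurable V -> borelsets X [set x | dom X x /\ V (g x)].
Arguments borel_map : clear implicits.
Arguments borel_fun : clear implicits.

Lemma preimage_sigma (X Y : Defs.space) (f : car X -> car Y) (A : set (car Y)) :
  (forall x, dom X x -> A (f x)) ->
  sigma_algebra A [set E | borelsets X (f @^-1` E `&` dom X)].
Proof.
move=> fA; split => [|E /= hE|F hF] /=.
- by rewrite preimage_set0 set0I; exact: borelsets0.
- have -> : f @^-1` (A `\` E) `&` dom X = dom X `\` (f @^-1` E `&` dom X).
    apply/seteqP; split=> x; first by move=> [[_ nE] Dx]; split => // -[].
    by move=> [Dx h]; split => //; split; [exact: fA|move=> Ex; apply: h].
  exact: borelsetsD.
- have -> : f @^-1` (\bigcup_k F k) `&` dom X = \bigcup_k (f @^-1` F k `&` dom X).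
    by rewrite preimage_bigcup setI_bigcupl.
  exact: borelsetsU.
Qed.

Lemma borel_map_open (X Y : Defs.space) (f : car X -> car Y) :
  (forall x, dom X x -> dom Y (f x)) ->
  (forall U, opens Y U -> borelsets X (f @^-1` U `&` dom X)) -> borel_map X Y f.
Proof.
move=> fD h; split => // E.
apply: (@borelsets_min Y [set E | borelsets X (f @^-1` E `&` dom X)]) => //.
exact: preimage_sigma.
Qed.

Lemma borel_map_comp (X Y Z : Defs.space) (f : car X -> car Y) (g : car Y -> car Z) :
  borel_map X Y f -> borel_map Y Z g -> borel_map X Z (g \o f).
Proof.
move=> [fD fm] [gD gm]; split; first by move=> x /fD/gD.
move=> E /gm/fm; congr borelsets; apply/seteqP; split=> x.
  by move=> [[]].
by move=> [? Dx]; split => //; split => //; exact: fD.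
Qed.

Lemma borel_fun_comp (X Y : Defs.space) (f : car X -> car Y) (g : car Y -> R) :
  borel_map X Y f -> borel_fun Y g -> borel_fun X (g \o f).
Proof.
move=> [fD fm] gm V /gm/fm; congr borelsets; apply/seteqP; split=> x.
  by move=> [[]].
by move=> [Dx ?]; split => //; split => //; exact: fD.
Qed.

Lemma borel_fun_rays (X : Defs.space) (g : car X -> R) :
  (forall a : R, borelsets X [set x | dom X x /\ a < g x]) -> borel_fun X g.
Proof.
move=> h V mV.
pose M := [set V : set (measurableTypeR R) | borelsets X [set x | dom X x /\ V (g x)]].
suff : <<s @RGenOInfty.G R >> `<=` M.
  by apply; move: mV; rewrite (RGenOInfty.measurableE R).
apply: smallest_sub; last first.
  move=> _ [a ->]; rewrite /M /=; have := h a; congr borelsets.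
  by apply/seteqP; split => x /=; rewrite in_itv /= andbT.
split; rewrite /M /=.
- by have -> : [set x | dom X x /\ set0 (g x)] = set0;
    [apply/seteqP; split => x // []|exact: borelsets0].
- move=> A /borelsetsD; congr borelsets; apply/seteqP; split=> x.
    by move=> [Dx hx]; split => //; split => // Ax; exact: hx.
  by move=> [Dx [_ hx]]; split => // -[].
- move=> A /borelsetsU; congr borelsets; apply/seteqP; split=> x.
    by move=> [n _ [Dx hx]]; split => //; exists n.
  by move=> [Dx [n _ hx]]; exists n.
Qed.

Lemma borel_fun_coord (X : Defs.space) phi k : coordinates X phi -> borel_fun X (phi k).
Proof.
move=> cX; apply: borel_fun_rays => a; apply: (borelsets_open cX).
apply/(cX.1 _); split; first by move=> x [].
move=> x [Dx ax]; exists k.+1, (phi k x - a); split; first by rewrite subr_gt0.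
move=> y Dy /(_ k (ltnSn k)) /ltr_normlP[]; split => //; lra.
Qed.

Definition ratR (q : rat) : R := ratr q.

Lemma rat_between (x y : R) : x < y -> exists q, x < ratR q /\ ratR q < y.
Proof.
by move=> /rat_in_itvoo[q]; rewrite in_itv => /andP[? ?]; exists q.
Qed.

Lemma rat_approx (x e : R) : 0 < e -> exists q, `|x - ratR q| < e.
Proof.
move=> e0; have [|q [h1 h2]] := @rat_between (x - e) (x + e); first lra.
exists q; apply/ltr_normlP; split; lra.
Qed.

(** An open set is the union of the rational boxes it contains. There are countably many of them,
    and the preimage of each is a finite intersection of conditions on single coordinates. *)
Lemma borel_map_coord (X Y : Defs.space) phi (f : car X -> car Y) : coordinates Y phi ->
  (forall x, dom X x -> dom Y (f x)) -> (forall k, borel_fun X (phi k \o f)) ->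
  borel_map X Y f.
Proof.
move=> cY fD fm; apply: borel_map_open => // U oU.
pose box (c : seq rat * rat) := [set y | dom Y y /\
  forall k, (k < size c.1)%N -> `|phi k y - ratR (nth 0 c.1 k)| < ratR c.2].
have -> : f @^-1` U `&` dom X = [set x | exists c,
    (if pselect (box c `<=` U) then f @^-1` box c `&` dom X else set0) x].
  apply/seteqP; split=> x /=.
    move=> [Ux Dx]; have [n [e [e0 hn]]] := coordinates_nbhd cY oU Ux.
    (* Centres within r of the coordinates of f x and a radius r below e/2 keep the box inside the
       e-neighbourhood. *)
    have [|r [r0 re]] := @rat_between 0 (e / 2); first by rewrite divr_gt0.
    have /choice[q hq] := fun k => @rat_approx (phi k (f x)) (ratR r) r0.
    exists (mkseq q n, r); case: pselect => /= [_|[]].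
      split => //; split; first exact: fD.
      by rewrite /= size_mkseq => k kn; rewrite nth_mkseq.
    move=> y [Dy] /=; rewrite size_mkseq => hy; apply: hn => // k kn.
    have /= h1 := hy k kn; rewrite nth_mkseq // in h1.
    have := ler_distD (ratR (q k)) (phi k y) (phi k (f x)).
    by have h3 := hq k; rewrite distrC in h3; lra.
  by move=> [c]; case: pselect => //= sub [/sub].
apply: borelsets_bigcup_count => c; case: pselect => /= _; last exact: borelsets0.
suff h n : borelsets X [set x | dom X x /\ forall k, (k < n)%N ->
    `|phi k (f x) - ratR (nth 0 c.1 k)| < ratR c.2].
  have := h (size c.1); congr borelsets; apply/seteqP; split=> x.
    by move=> [Dx hx]; split => //; split => //; exact: fD.
  by move=> [[_ hx] Dx].
elim: n => [|n IH].
  by have := borelsetsT X; congr borelsets; apply/seteqP; split=> x //; case.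
have := borelsetsI IH (fm n (ball (ratR (nth 0 c.1 n) : R) (ratR c.2)) (measurable_ball _ _)).
congr borelsets; apply/seteqP; split=> x.
  move=> [[Dx hx] [_]]; rewrite /ball /= distrC => hn; split => // k.
  by rewrite ltnS leq_eqVlt => /orP[/eqP ->|kn]; [|exact: hx].
move=> [Dx hx]; split; split => //; first by move=> k kn; apply: hx; exact: ltnW.
by rewrite /ball /= distrC; exact: hx.
Qed.

Lemma borel_map_pair (X Y Z : Defs.space) phi psi (f : car X -> car Y) (g : car X -> car Z) :
  coordinates Y phi -> coordinates Z psi -> borel_map X Y f -> borel_map X Z g ->
  borel_map X (prod_space Y Z) (fun x => (f x, g x)).
Proof.
move=> cY cZ fm gm; apply: (borel_map_coord (prod_coordinates cY cZ)).
  by move=> x Dx; split; [exact: fm.1|exact: gm.1].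
move=> k; rewrite /prod_coord /comp /=; case: odd.
  exact: (borel_fun_comp gm (borel_fun_coord _ cZ)).
exact: (borel_fun_comp fm (borel_fun_coord _ cY)).
Qed.

Lemma borel_map_fst (X Y : Defs.space) phi psi : coordinates X phi -> coordinates Y psi ->
  borel_map (prod_space X Y) X fst.
Proof.
move=> cX cY; apply: (borel_map_coord cX) => [x []//|k].
have := borel_fun_coord k.*2 (prod_coordinates cX cY); congr borel_fun.
by apply/funext => z; rewrite /prod_coord odd_double doubleK.
Qed.

Lemma borel_map_snd (X Y : Defs.space) phi psi : coordinates X phi -> coordinates Y psi ->
  borel_map (prod_space X Y) Y snd.
Proof.
move=> cX cY; apply: (borel_map_coord cY) => [x []//|k].
have := borel_fun_coord k.*2.+1 (prod_coordinates cX cY); congr borel_fun.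
by apply/funext => z; rewrite /prod_coord /= odd_double /= uphalf_double.
Qed.

Lemma borel_map_sub (X Y : Defs.space) phi (A : set (car Y)) (f : car X -> car Y) :
  coordinates Y phi -> borel_map X Y f -> (forall x, dom X x -> A (f x)) ->
  borel_map X (sub_space Y A) f.
Proof.
move=> cY fm fA; apply: (borel_map_coord (sub_coordinates A cY)).
  by move=> x Dx; split; [exact: fA|exact: fm.1].
by move=> k; exact: (borel_fun_comp fm (borel_fun_coord _ cY)).
Qed.

Lemma borel_map_sub_incl (Y : Defs.space) phi (A : set (car Y)) : coordinates Y phi ->
  borel_map (sub_space Y A) Y id.
Proof.
move=> cY; apply: (borel_map_coord cY) => [x []//|k].
exact: (borel_fun_coord _ (sub_coordinates A cY)).
Qed.

(** * Integrals with respect to Borel probability measures *)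

Section IntegralsModuloNullSets.
Context d (T : measurableType d) (K : realType) (m : {measure set T -> \bar K}).
Variable A : set T.
Hypotheses (mA : measurable A) (mA0 : m (~` A) = 0%E).

(* No measurability is assumed of f and g: the integral of a nonnegative
   function is a supremum over the simple functions below it. *)
Lemma ge0_le_integral_off_null (f g : T -> \bar K) :
  (forall x, (0 <= f x)%E) -> (forall x, (0 <= g x)%E) ->
  (forall x, A x -> (f x <= g x)%E) ->
  (\int[m]_x f x <= \int[m]_x g x)%E.
Proof.
move=> f0 g0 fg; rewrite !ge0_integralTE//; apply: ge_ereal_sup => _ [h /= hf <-].
(* Cutting h off outside A keeps its integral, as the complement of A is null, and puts it below g
   everywhere. *)
have [h' h'E] : exists h' : {nnsfun T >-> K}, forall x, h' x = h x * (x \in A)%:R.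
  by exists (proj_nnsfun h mA) => x /=; rewrite mindicE.
apply: ereal_sup_ubound; exists h' => /=.
  move=> x; rewrite h'E; case: (pselect (A x)) => Ax.
    by rewrite mem_set// mulr1; exact: le_trans (hf x) (fg x Ax).
  by rewrite memNset// mulr0.
rewrite -!integralT_nnsfun; apply: ge0_ae_eq_integral.
- exact: measurableT.
- exact/measurable_EFinP.
- exact/measurable_EFinP.
- by move=> x _; rewrite lee_fin.
- by move=> x _; rewrite lee_fin.
exists (~` A); split; [exact: measurableC|exact: mA0|].
move=> x /= hx Ax; apply: hx => _.
by rewrite h'E mem_set// mulr1.
Qed.

(** Used to replace the integrand of [pint], which is uncontrolled outside [dom X], by the
    measurable [bor_fun]. *)
Lemma eq_integral_off_null (f g : T -> \bar K) :
  (forall x, A x -> f x = g x) -> (\int[m]_x f x = \int[m]_x g x)%E.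
Proof.
move=> fg; rewrite integralE [RHS]integralE; congr (_ - _)%E.
  by apply/eqP; rewrite eq_le; apply/andP; split; apply: ge0_le_integral_off_null => // x Ax;
    rewrite funeposE [leRHS]funeposE fg.
by apply/eqP; rewrite eq_le; apply/andP; split; apply: ge0_le_integral_off_null => // x Ax;
  rewrite funenegE [leRHS]funenegE fg.
Qed.

End IntegralsModuloNullSets.

Section BorelOption.
Variables (X : Defs.space) (phi : nat -> car X -> R).
Hypothesis cX : coordinates X phi.

Lemma borelsets_bor (A : set (bor X)) : measurable A -> borelsets X (Some @^-1` A `&` dom X).
Proof.
pose M := [set A : set (bor X) | borelsets X (Some @^-1` A `&` dom X)].
have : <<s [set Some @` U | U in opens X] >> `<=` M.
  apply: smallest_sub.
    split; rewrite /M /=.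
    - by rewrite preimage_set0 set0I; exact: borelsets0.
    - move=> B /borelsetsD; congr borelsets; apply/seteqP; split=> x.
        by move=> [Dx h]; split => //; split => // Bx; exact: h.
      by move=> [[_ nB] Dx]; split => // -[].
    - by move=> F /borelsetsU; rewrite preimage_bigcup setI_bigcupl.
  move=> _ [U oU <-]; rewrite /M /=; have := borelsets_open cX oU; congr borelsets.
  apply/seteqP; split=> x; first by move=> Ux; split; [exists x|exact: (coordinates_dom cX oU)].
  by move=> [[y Uy [<-]]].
exact.
Qed.

Lemma measurable_bor (E : set (car X)) : borelsets X E -> measurable (Some @` E : set (bor X)).
Proof.
pose M := [set E : set (car X) | measurable (Some @` E : set (bor X))].
have mO U : opens X U -> measurable (Some @` U : set (bor X)).
  by move=> oU; apply: sub_gen_smallest; exists U.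
move=> BE; apply: (@borelsets_min X M _ _ E BE) => //.
split; rewrite /M /=.
- by rewrite image_set0.
- move=> B mB; have -> : Some @` (dom X `\` B) = (Some @` dom X : set (bor X)) `\` Some @` B.
    apply/seteqP; split => [_ [x [Dx nB] <-]|_ [[x Dx <-] h]].
      by split; [exists x|move=> [y By [xy]]; apply: nB; rewrite -xy].
    by exists x => //; split => // Bx; apply: h; exists x.
  by apply: measurableD => //; apply: mO; exact: (coordinates_openT cX).
- by move=> F mF; rewrite image_bigcup; exact: bigcupT_measurable.
Qed.

Definition dom_bor : set (bor X) := Some @` dom X.

Lemma measurable_dom_bor : measurable dom_bor.
Proof. by apply: measurable_bor; exact: borelsetsT. Qed.

(** Extension by 0 outside [dom X] and at [None], which makes a Borel function measurable on all of
    [bor X]. *)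
Definition bor_fun (f : car X -> R) (x : bor X) : R :=
  if x is Some y then if `[< dom X y >] then f y else 0 else 0.

Lemma bor_funE f x : dom X x -> bor_fun f (Some x) = f x.
Proof. by move=> Dx; rewrite /bor_fun asboolT. Qed.

Lemma measurable_bor_fun f : borel_fun X f ->
  measurable_fun [set: bor X] (bor_fun f : bor X -> measurableTypeR R).
Proof.
move=> mf _ V mV; rewrite setTI.
have -> : bor_fun f @^-1` V = (Some @` [set x | dom X x /\ V (f x)]) `|`
    (if `[< V 0 >] then ~` dom_bor else set0).
  apply/seteqP; split=> [[x|]|[x|]] /=.
  - case: (pselect (dom X x)) => [Dx|nD]; first by rewrite asboolT// => Vx; left; exists x.
    rewrite asboolF// => V0; right; rewrite asboolT// => -[y Dy [yx]].
    by apply: nD; rewrite -yx.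
  - by move=> V0; right; rewrite asboolT// => -[y Dy].
  - move=> [[y [Dy Vy] [<-]]|]; first by rewrite asboolT.
    case: asboolP => // V0 h; rewrite asboolF// => Dx; apply: h; by exists x.
  - by move=> [[y [Dy Vy]]//|]; case: asboolP.
apply: measurableU; first by apply: measurable_bor; exact: mf.
by case: asboolP => // _; apply: measurableC; exact: measurable_dom_bor.
Qed.

Section BorelProbability.
Variables (mu : set (car X) -> \bar R).
Hypothesis pmu : is_prob X mu.

(** The two proofs are arguments so that the measure and probability structures declared below can
    be attached to the term itself. *)
Definition bor_measure (_ : coordinates X phi) (_ : is_prob X mu) (A : set (bor X)) : \bar R :=
  mu (Some @^-1` A `&` dom X).
Let m := bor_measure cX pmu.

Let m0 : m set0 = 0%E.
Proof. by rewrite /m /bor_measure preimage_set0 set0I; case: pmu. Qed.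

Let m_ge0 A : (0 <= m A)%E.
Proof.
have [p1 p2 _ _ _] := pmu.
by have [h|h] := pselect (borelsets X (Some @^-1` A `&` dom X));
  [exact: p2|rewrite /m /bor_measure p1].
Qed.

Let m_sigma : semi_sigma_additive m.
Proof.
move=> F mF tF mUF; have [_ _ _ _ p] := pmu.
rewrite /m /bor_measure preimage_bigcup setI_bigcupl.
under eq_fun do rewrite big_mkord.
apply: p; first by move=> n; exact: borelsets_bor.
move=> i j _ _ [x [[Fx _] [Fy _]]]; apply: tF => //.
by exists (Some x).
Qed.

HB.instance Definition _ := isMeasure.Build _ _ _ (bor_measure cX pmu) m0 m_ge0 m_sigma.

Let mT : bor_measure cX pmu setT = 1%E.
Proof. by rewrite /bor_measure preimage_setT setTI; case: pmu. Qed.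

HB.instance Definition _ := Measure_isProbability.Build _ _ _ (bor_measure cX pmu) mT.

Lemma bor_measure_null : bor_measure cX pmu (~` dom_bor) = 0%E.
Proof.
rewrite /bor_measure; have -> : Some @^-1` (~` dom_bor) `&` dom X = set0.
  by apply/seteqP; split=> x // [h Dx]; apply: h; exists x.
by case: pmu.
Qed.

Lemma bor_measure_image E : E `<=` dom X -> bor_measure cX pmu (Some @` E) = mu E.
Proof.
move=> ED; rewrite /bor_measure; congr mu; apply/seteqP; split=> x.
  by move=> [[y Ey [<-]]].
by move=> Ex; split; [exists x|exact: ED].
Qed.

Lemma pintE f : pint X mu f = (\int[bor_measure cX pmu]_x (bor_fun f x)%:E)%E.
Proof.
apply: (eq_integral_off_null measurable_dom_bor bor_measure_null).
by move=> _ [x Dx <-]; rewrite bor_funE.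
Qed.

End BorelProbability.
End BorelOption.

(** * Expectations of bounded Borel functions *)

Definition expect (X : Defs.space) (mu : set (car X) -> \bar R) (f : car X -> R) : R :=
  fine (pint X mu f).
Arguments expect : clear implicits.

Definition bounded_borel (X : Defs.space) (f : car X -> R) : Prop :=
  borel_fun X f /\ exists M : R, forall x, dom X x -> `|f x| <= M.
Arguments bounded_borel : clear implicits.

Section Expectation.
Variables (X : Defs.space) (phi : nat -> car X -> R).
Hypothesis cX : coordinates X phi.
Variables (mu : set (car X) -> \bar R).
Hypothesis pmu : is_prob X mu.

Let m := bor_measure cX pmu.

Lemma integrable_bor_fun f : bounded_borel X f ->
  m.-integrable [set: bor X] (EFin \o bor_fun f).
Proof.
move=> [mf [M hM]]; apply: measurable_bounded_integrable => //.
- by apply: (@le_lt_trans _ _ 1%E); [exact: probability_le1|exact: ltry].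
- exact: (measurable_bor_fun cX mf).
exists `|M|; split; first exact: num_real.
move=> N MN [x|] _ /=; last by rewrite normr0; apply: le_trans (ltW MN).
case: asboolP => [Dx|_]; last by rewrite normr0; apply: le_trans (ltW MN).
by apply: le_trans (ltW MN); apply: le_trans (hM x Dx) (ler_norm _).
Qed.

Lemma expectE f : expect X mu f = \int[m]_(x in [set: bor X]) bor_fun f x.
Proof. by rewrite /expect (pintE cX pmu). Qed.

Lemma pint_expect f : bounded_borel X f -> pint X mu f = (expect X mu f)%:E.
Proof.
move=> hf; rewrite /expect fineK// (pintE cX pmu).
exact: (integrable_fin_num measurableT (integrable_bor_fun hf)).
Qed.

Lemma expect_le f g : bounded_borel X f -> bounded_borel X g ->
  (forall x, dom X x -> f x <= g x) -> expect X mu f <= expect X mu g.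
Proof.
move=> hf hg fg; rewrite !expectE; apply: le_Rintegral => //.
- exact: integrable_bor_fun.
- exact: integrable_bor_fun.
by move=> [x|] _ //=; case: asboolP => // Dx; exact: fg.
Qed.

Lemma expect_affine f a b : bounded_borel X f ->
  expect X mu (fun x => a * f x + b) = a * expect X mu f + b.
Proof.
move=> hf; have i1 := integrable_bor_fun hf.
have i2 : m.-integrable [set: bor X] (EFin \o cst b).
  exact: finite_measure_integrable_cst.
have i3 : m.-integrable [set: bor X] (EFin \o (fun x => a * bor_fun f x)).
  have := integrableZl measurableT a i1; congr (_.-integrable _ _).
transitivity (\int[m]_(x in [set: bor X]) (a * bor_fun f x + cst b x)).
  rewrite expectE; congr fine.
  apply: (eq_integral_off_null (measurable_dom_bor cX) (bor_measure_null cX pmu)).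
  by move=> _ [x Dx <-]; rewrite !bor_funE.
rewrite RintegralD// RintegralZl// Rintegral_cst// expectE.
have mT : fine (m setT) = 1.
  by rewrite /m /bor_measure preimage_setT setTI; case: pmu => _ _ _ ->.
by congr (_ + _); rewrite -[RHS]mulr1; congr (_ * _).
Qed.

(** Monotone convergence in contrapositive form: if every expectation of F n stayed below a, so
    would that of the supremum f. *)
Lemma expect_gt_sup (F : nat -> car X -> R) f (a : R) :
  (forall n, bounded_borel X (F n)) -> bounded_borel X f ->
  (forall n x, dom X x -> 0 <= F n x) ->
  (forall n x, dom X x -> F n x <= F n.+1 x) ->
  (forall n x, dom X x -> F n x <= f x) ->
  (forall x (e : R), dom X x -> 0 < e -> exists n, f x - e < F n x) ->
  a < expect X mu f -> exists n, a < expect X mu (F n).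
Proof.
move=> hF hf F0 Fi Ff Fs af; apply: contrapT => /forallNP hno.
have Fmono n k x : dom X x -> (n <= k)%N -> F n x <= F k x.
  move=> Dx nk; rewrite -(subnKC nk); elim: (k - n)%N => [|j IH]; first by rewrite addn0.
  by rewrite addnS; apply: le_trans IH (Fi _ _ Dx).
have mF n : measurable_fun [set: bor X] (EFin \o bor_fun (F n)).
  by apply/measurable_EFinP; exact: (measurable_bor_fun cX (hF n).1).
have mono : forall x, [set: bor X] x ->
    {homo (fun n => (EFin \o bor_fun (F n)) x) : n k / (n <= k)%N >-> (n <= k)%E}.
  move=> [x|] _ n k nk; rewrite lee_fin //=.
  by case: asboolP => // Dx; exact: Fmono.
have pos n x : [set: bor X] x -> (0 <= (EFin \o bor_fun (F n)) x)%E.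
  by case: x => [x|] _; rewrite lee_fin //=; case: asboolP => // Dx; exact: F0.
have lim x : limn (fun n => (EFin \o bor_fun (F n)) x) = (bor_fun f x)%:E.
  apply/cvg_lim => //; apply: cvg_EFin; first by near=> n.
  case: x => [x|] /=; last exact: cvg_cst.
  case: (pselect (dom X x)) => [Dx|nD]; last first.
    by rewrite asboolF//; exact: cvg_cst.
  rewrite asboolT//.
  apply/(@cvgrPdist_lt R R^o) => e e0; have [N hN] := Fs x e Dx e0.
  exists N => // n /= Nn; have := Fmono N n x Dx Nn; have := Ff n x Dx => h1 h2.
  by rewrite ger0_norm; lra.
have := monotone_convergence m measurableT mF pos mono.
have -> : (fun x => limn (fun n => (EFin \o bor_fun (F n)) x)) = EFin \o bor_fun f.
  by apply/funext.
rewrite -(pintE cX pmu) pint_expect // => E.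
have : (limn (fun n => \int[m]_x (EFin \o bor_fun (F n)) x) <= a%:E)%E.
  apply: lime_le.
    apply: ereal_nondecreasing_is_cvgn => n k nk; apply: ge0_le_integral => //.
    - by move=> x _; exact: pos.
    - by move=> x _; exact: mono.
  near=> n; rewrite -(pintE cX pmu) pint_expect // lee_fin leNgt; apply/negP; exact: hno.
by rewrite -E lee_fin leNgt af.
Unshelve. all: by end_near. Qed.

Lemma pint_indic E : borelsets X E -> pint X mu (\1_E : car X -> R) = mu E.
Proof.
move=> BE; rewrite (pintE cX pmu).
transitivity (\int[m]_(x in [set: bor X]) (\1_(Some @` E : set (bor X)) x)%:E)%E.
  apply: eq_integral => -[x|] _ /=.
    case: (pselect (E x)) => Ex.
      rewrite asboolT; last exact: BE.2.
      by rewrite !indicE !mem_set//; exists x.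
    rewrite [in RHS]indicE memNset; last by move=> [y Ey [yx]]; apply: Ex; rewrite -yx.
    by case: asboolP => // _; rewrite indicE memNset.
  by rewrite indicE memNset// => -[].
rewrite integral_indic//; last exact: (measurable_bor cX).
by rewrite setIT; exact: (bor_measure_image cX pmu BE.2).
Qed.

End Expectation.

Lemma is_prob_le1 (X : Defs.space) phi mu E : coordinates X phi -> is_prob X mu ->
  (mu E <= 1)%E.
Proof.
move=> cX pmu; have [p1 _ _ _ _] := pmu.
have [BE|nB] := pselect (borelsets X E); last by rewrite p1.
rewrite -(bor_measure_image cX pmu BE.2); apply: probability_le1.
exact: (measurable_bor cX BE).
Qed.

Lemma is_prob_setD (X : Defs.space) phi mu E : coordinates X phi -> is_prob X mu ->
  borelsets X E -> mu (dom X `\` E) = (1 - mu E)%E.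
Proof.
move=> cX pmu BE; have BC := borelsetsD BE.
rewrite -(bor_measure_image cX pmu BC.2) -(bor_measure_image cX pmu BE.2).
have -> : (Some @` (dom X `\` E) : set (bor X)) = (dom_bor (X:=X)) `\` (Some @` E).
  apply/seteqP; split => [_ [x [Dx nB] <-]|_ [[x Dx <-] h]].
    by split; [exists x|move=> [y By [xy]]; apply: nB; rewrite -xy].
  by exists x => //; split => // Bx; apply: h; exists x.
rewrite measureD//=.
- congr (_ - _)%E.
    by rewrite (bor_measure_image cX pmu (@subset_refl _ _)); case: pmu.
  by congr (bor_measure _ _ _); apply/setIidr; apply: image_subset; exact: BE.2.
- exact: (measurable_dom_bor cX).
- exact: (measurable_bor cX).
- apply: (@le_lt_trans _ _ 1%E); last exact: ltry.
  by apply: probability_le1; exact: (measurable_dom_bor cX).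
Qed.

(** * Image measures *)

Section Marginals.
Variables (X Y : Defs.space) (J : Type) (mu : J -> set (car X) -> \bar R).

Lemma margE (f : car X -> car Y) k E : borelsets Y E ->
  marg Y X f mu k E = mu k (f @^-1` E `&` dom X).
Proof. by move=> BE; rewrite /marg asboolT. Qed.

Lemma marg_prob (f : car X -> car Y) k : borel_map X Y f -> is_prob X (mu k) ->
  is_prob Y (marg Y X f mu k).
Proof.
move=> [fD fm] [p1 p2 p3 p4 p5]; split.
- by move=> A nB; rewrite /marg asboolF.
- by move=> A BA; rewrite margE//; apply: p2; exact: fm.
- by rewrite margE; [rewrite preimage_set0 set0I|exact: borelsets0].
- rewrite margE; last exact: borelsetsT.
  by rewrite -p4; congr mu; apply/seteqP; split=> x; [move=> []|move=> Dx; split => //; exact: fD].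
- move=> F BF tF; rewrite margE; last exact: borelsetsU.
  rewrite preimage_bigcup setI_bigcupl.
  have -> : (fun n => \sum_(k0 < n) marg Y X f mu k (F k0))%E =
      (fun n => \sum_(k0 < n) mu k (f @^-1` F k0 `&` dom X))%E.
    by apply/funext => n; apply: eq_bigr => i _; rewrite margE.
  apply: p5; first by move=> n; exact: fm.
  by move=> i j _ _ [x [[Fx _] [Fy _]]]; apply: tF => //; exists (f x).
Qed.

Lemma pint_marg phi psi (f : car X -> car Y) g k : coordinates X phi -> coordinates Y psi ->
  borel_map X Y f -> is_prob X (mu k) -> borel_fun Y g -> (forall y, dom Y y -> 0 <= g y) ->
  pint Y (marg Y X f mu k) g = pint X (mu k) (g \o f).
Proof.
move=> cX cY fm pmu gm g0; have [fD fE] := fm.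
have pY := marg_prob fm pmu.
(* The lift of f to the auxiliary types sends everything outside [dom X] to [None]; it is measurable
   whatever f does there, and the image measure is its pushforward. *)
pose F (x : bor X) : bor Y := if x is Some x' then
  if `[< dom X x' >] then Some (f x') else None else None.
have mF : measurable_fun [set: bor X] F.
  move=> _ A mA; rewrite setTI.
  have -> : F @^-1` A = (Some @` (f @^-1` (Some @^-1` A `&` dom Y) `&` dom X)) `|`
      (if `[< A None >] then ~` (dom_bor (X:=X)) else set0).
    apply/seteqP; split=> [[x|]|[x|]] /=.
    - case: (pselect (dom X x)) => [Dx|nD].
        by rewrite asboolT// => Vx; left; exists x => //; split => //; split => //; exact: fD.
      rewrite asboolF// => V0; right; rewrite asboolT// => -[y Dy [yx]].
      by apply: nD; rewrite -yx.
    - by move=> V0; right; rewrite asboolT// => -[y Dy].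
    - move=> [[y [[Ay _] Dy] [<-]]|]; first by rewrite asboolT.
      case: asboolP => // V0 h; rewrite asboolF// => Dx; apply: h; by exists x.
    - by move=> [[y _]//|]; case: asboolP.
  apply: measurableU.
    by apply: (measurable_bor cX); apply: fE; exact: (borelsets_bor cY).
  by case: asboolP => // _; apply: measurableC; exact: (measurable_dom_bor cX).
rewrite (pintE cY pY) (pintE cX pmu).
have mE A : measurable A -> bor_measure cY pY A = pushforward (bor_measure cX pmu) F A.
  move=> mA; rewrite /pushforward /bor_measure margE; last exact: (borelsets_bor cY).
  congr mu; apply/seteqP; split=> x.
    by move=> [[Ax _] Dx]; split => //=; rewrite asboolT.
  by move=> [/= + Dx]; rewrite asboolT// => Ax; split => //; split => //; exact: fD.
transitivity (\int[pushforward (bor_measure cX pmu) F]_y (bor_fun g y)%:E)%E.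
  by apply: (eq_measure_integral (pushforward (bor_measure cX pmu) F)) => A mA _; exact: mE.
rewrite ge0_integral_pushforward //.
- rewrite preimage_setT; apply: eq_integral => -[x|] _ //=.
  case: asboolP => // Dx /=; rewrite asboolT//; exact: fD.
- by apply/measurable_EFinP; exact: (measurable_bor_fun cY gm).
- move=> [y|] _; rewrite lee_fin //=; case: asboolP => // Dy; exact: g0.
Qed.

End Marginals.

Lemma marg_marg (X Y Z : Defs.space) (J : Type) (mu : J -> set (car X) -> \bar R)
  (f : car X -> car Y) (g : car Y -> car Z) :
  (forall x, dom X x -> dom Y (f x)) -> borel_map Y Z g ->
  marg Z Y g (marg Y X f mu) = marg Z X (g \o f) mu.
Proof.
move=> fD [gD gm]; apply/funext => k; apply/funext => E.
rewrite {1 3}/marg; case: asboolP => // BE; rewrite margE; last exact: gm.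
congr mu; apply/seteqP; split=> x.
  by move=> [[]].
by move=> [? Dx]; split => //; split => //; exact: fD.
Qed.

Lemma eq_marg (X Y : Defs.space) (J : Type) (mu : J -> set (car X) -> \bar R)
  (f g : car X -> car Y) : (forall x, dom X x -> f x = g x) ->
  marg Y X f mu = marg Y X g mu.
Proof.
move=> fg; apply/funext => k; apply/funext => E; rewrite /marg; congr (if _ then _ else _).
by congr mu; apply/seteqP; split=> x [h Dx]; split => //; move: h; rewrite /preimage /= fg.
Qed.

(** * The weak topology is separable and metrizable *)

Lemma setI_closed_opens (X : Defs.space) phi : coordinates X phi -> setI_closed (opens X).
Proof.
move=> cX U V oU oV; apply/(cX.1 _); split.
  by move=> x [Ux _]; exact: (coordinates_dom cX oU).
move=> x [Ux Vx].
have hk k : (k < 2)%N -> coord_nbhd (dom X) phi x (if k == 0%N then U else V).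
  by move=> _; case: ifP => _; exact: (coordinates_nbhd cX).
have := coord_nbhd_fin hk; apply: coord_nbhd_sub => y [hy Dy].
by split; [exact: (hy 0%N)|exact: (hy 1%N)].
Qed.

(** The pi-lambda theorem relative to [dom X], obtained from the one on the full type by passing to
    traces. P' also records that the trace is Borel, since the closure properties of P are granted
    for Borel sets only. *)
Lemma borelsets_dynkin (X : Defs.space) (G P : set (set (car X))) :
  setI_closed G -> G `<=` borelsets X -> borelsets X `<=` <<s dom X, G >> ->
  G `<=` P -> P (dom X) ->
  (forall E, borelsets X E -> P E -> P (dom X `\` E)) ->
  (forall F : nat -> set (car X), (forall n, borelsets X (F n)) -> trivIset setT F ->
    (forall n, P (F n)) -> P (\bigcup_n F n)) ->
  borelsets X `<=` P.
Proof.
move=> GI GB BG GP PT PC PU E BE.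
pose P' := [set A : set (car X) | borelsets X (A `&` dom X) /\ P (A `&` dom X)].
have GD A : G A -> A `&` dom X = A.
  by move=> /GB[_ AD]; apply/setIidl.
have dP' : dynkin P'.
  split; rewrite /P'.
  - by rewrite /= setTI; split; [exact: borelsetsT|].
  - move=> A /= [BA PA]; have -> : ~` A `&` dom X = dom X `\` (A `&` dom X).
      by apply/seteqP; split=> x; [move=> [nA Dx]; split => // -[]|
        move=> [Dx h]; split => // Ax; apply: h].
    by split; [exact: borelsetsD|exact: PC].
  - move=> F tF hF /=; rewrite setI_bigcupl.
    split; first by apply: borelsetsU => n; exact: (hF n).1.
    apply: PU => [n||n]; [exact: (hF n).1| |exact: (hF n).2].
    by move=> i j _ _ [x [[Fx _] [Fy _]]]; apply: tF => //; exists x.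
have GP' : <<s G >> `<=` P'.
  rewrite -(setI_closed_g_dynkin_g_sigma_algebra GI); apply: smallest_sub => //.
  by move=> A GA; rewrite /P' /= GD//; split; [exact: GB|exact: GP].
have [s0 sC sU] := @smallest_sigma_algebra _ setT G.
have : <<s dom X, G >> `<=` [set E | exists A, <<s G >> A /\ E = A `&` dom X].
  apply: smallest_sub; last first.
    by move=> A GA; exists A; rewrite GD//; split => //; exact: sub_gen_smallest.
  split.
  - by exists set0; rewrite set0I.
  - move=> _ [A [sA ->]]; exists (setT `\` A); split; first exact: sC.
    by rewrite setTD; apply/seteqP; split=> x; [move=> [Dx h]; split => // Ax; apply: h|
      move=> [nA Dx]; split => // -[]].
  - move=> F /choice[A hA]; exists (\bigcup_n A n); split.
      by apply: sU => n; exact: (hA n).1.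
    by rewrite setI_bigcupl; apply: eq_bigcupr => n _; exact: (hA n).2.
by move=> /(_ E (BG E BE))[A [sA ->]]; exact: (GP' A sA).2.
Qed.

Lemma is_prob_eq (X : Defs.space) phi (G : set (set (car X))) mu nu : coordinates X phi ->
  setI_closed G -> G `<=` borelsets X -> borelsets X `<=` <<s dom X, G >> ->
  is_prob X mu -> is_prob X nu -> (forall A, G A -> mu A = nu A) -> mu = nu.
Proof.
move=> cX GI GB BG pm pn e; apply/funext => E.
have [m1 m2 m3 m4 m5] := pm; have [n1 n2 n3 n4 n5] := pn.
have [BE|nB] := pselect (borelsets X E); last by rewrite m1// n1.
apply: (@borelsets_dynkin X G [set E | mu E = nu E]) BE => //=.
- by rewrite m4 n4.
- by move=> A BA h; rewrite (is_prob_setD cX pm BA) (is_prob_setD cX pn BA) h.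
- move=> F BF tF h; have := n5 F BF tF.
  rewrite (_ : (fun n => _) = (fun n => \sum_(k < n) mu (F k))%E); last first.
    by apply/funext => n; apply: eq_bigr => i _; rewrite h.
  by move=> c; rewrite -(cvg_lim _ (m5 F BF tF))// -(cvg_lim _ c).
Qed.

(* A countable family of continuous functions from which every nonnegative
   lower semicontinuous function is obtained as a supremum: finite maxima of
   rational truncations of integer multiples of "distances to the complement"
   of rational boxes. *)
Definition half_space {T : Type} (phi : nat -> T -> R) (t : nat * rat * bool) (x : T) : R :=
  if t.2 then phi t.1.1 x - ratR t.1.2 else ratR t.1.2 - phi t.1.1 x.

Definition box_depth {T : Type} (phi : nat -> T -> R) (l : seq (nat * rat * bool)) (x : T) : R :=
  foldr (fun t r => Num.min (half_space phi t x) r) 1 l.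

Definition bump_code : countType := (rat * nat * seq (nat * rat * bool))%type.

Definition bump {T : Type} (phi : nat -> T -> R) (c : bump_code) (x : T) : R :=
  Num.max 0 (Num.min (ratR c.1.1) (c.1.2%:R * box_depth phi c.2 x)).

Definition bumps {T : Type} (phi : nat -> T -> R) (L : seq bump_code) (x : T) : R :=
  foldr (fun c r => Num.max (bump phi c x) r) 0 L.

Section ContinuousFunctions.
Variables (T : Type) (D : set T) (phi : nat -> T -> R).

Definition coord_continuous (f : T -> R) : Prop :=
  forall x (e : R), D x -> 0 < e -> coord_nbhd D phi x [set y | `|f y - f x| < e].

Lemma coord_continuous2 (op : R -> R -> R) f g :
  (forall a b c d (e : R), `|a - c| < e -> `|b - d| < e -> `|op a b - op c d| < e) ->
  coord_continuous f -> coord_continuous g -> coord_continuous (fun x => op (f x) (g x)).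
Proof.
move=> hop cf cg x e Dx e0.
have hk k : (k < 2)%N -> coord_nbhd D phi x
    [set y | if k == 0%N then `|f y - f x| < e else `|g y - g x| < e].
  by case: k => [|k] _; [exact: cf|exact: cg].
have := coord_nbhd_fin hk; apply: coord_nbhd_sub => y [hy Dy] /=.
by apply: hop; [exact: (hy 0%N)|exact: (hy 1%N)].
Qed.

Lemma coord_continuous_min f g : coord_continuous f -> coord_continuous g ->
  coord_continuous (fun x => Num.min (f x) (g x)).
Proof.
apply: coord_continuous2 => a b c d e /ltr_normlP[h1 h2] /ltr_normlP[h3 h4].
by apply/ltr_normlP; case: (leP a b) => ?; case: (leP c d) => ?; split; lra.
Qed.

Lemma coord_continuous_max f g : coord_continuous f -> coord_continuous g ->
  coord_continuous (fun x => Num.max (f x) (g x)).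
Proof.
apply: coord_continuous2 => a b c d e /ltr_normlP[h1 h2] /ltr_normlP[h3 h4].
by apply/ltr_normlP; case: (leP a b) => ?; case: (leP c d) => ?; split; lra.
Qed.

Lemma coord_continuous_cst (a : R) : coord_continuous (fun=> a).
Proof. by move=> x e _ e0; exists 0%N, 1; split => // y _ _ /=; rewrite subrr normr0. Qed.

Lemma coord_continuous_natmul n f : coord_continuous f -> coord_continuous (fun x => n%:R * f x).
Proof.
move=> cf x e Dx e0; have n0 : 0 < n%:R + 1 :> R by rewrite ltr_wpDl.
(* Dividing by n + 1 instead of n covers n = 0. *)
have := cf x (e / (n%:R + 1)) Dx (divr_gt0 e0 n0).
apply: coord_nbhd_sub => y [/= hy _]; rewrite -mulrBr normrM ger0_norm//.
have : (n%:R + 1) * `|f y - f x| < e by rewrite mulrC -ltr_pdivlMr.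
by have := normr_ge0 (f y - f x); lra.
Qed.

Lemma coord_continuous_half_space t : coord_continuous (half_space phi t).
Proof.
move=> x e Dx e0; exists t.1.1.+1, e; split => // y Dy /(_ t.1.1 (ltnSn _)).
rewrite /half_space /=; case: t.2 => /ltr_normlP[h1 h2]; apply/ltr_normlP; split; lra.
Qed.

Lemma coord_continuous_bump c : coord_continuous (bump phi c).
Proof.
apply: coord_continuous_max; first exact: coord_continuous_cst.
apply: coord_continuous_min; first exact: coord_continuous_cst.
apply: coord_continuous_natmul; elim: c.2 => [|t l IH] /=; first exact: coord_continuous_cst.
by apply: coord_continuous_min; first exact: coord_continuous_half_space.
Qed.

Lemma coord_continuous_bumps L : coord_continuous (bumps phi L).
Proof.
elim: L => [|c L IH] /=; first exact: coord_continuous_cst.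
by apply: coord_continuous_max; first exact: coord_continuous_bump.
Qed.

Lemma bumps_cons c L x : bumps phi (c :: L) x = Num.max (bump phi c x) (bumps phi L x).
Proof. by []. Qed.

Lemma bumps_ge0 L x : 0 <= bumps phi L x.
Proof. by case: L => [|c L] //=; rewrite /bump -maxA le_max lexx. Qed.

Lemma bumps_bounded L : exists M : R, forall x, `|bumps phi L x| <= M.
Proof.
suff [M hM] : exists M : R, forall x, bumps phi L x <= M.
  by exists M => x; rewrite ger0_norm ?bumps_ge0.
elim: L => [|c L [M hM]]; first by exists 0.
exists (Num.max (Num.max 0 (ratR c.1.1)) M) => x /=.
rewrite ge_max; apply/andP; split; last by rewrite le_max hM orbT.
rewrite le_max; apply/orP; left; rewrite /bump ge_max; apply/andP; split; rewrite le_max ?lexx//.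
by apply/orP; right; rewrite ge_min lexx.
Qed.

Lemma box_depth_gt0 l x : (0 < box_depth phi l x) = all (fun t => 0 < half_space phi t x) l.
Proof. by elim: l => [|t l IH] /=; rewrite ?ltr01// lt_min IH. Qed.

End ContinuousFunctions.

Section LowerSemicontinuous.
Variables (X : Defs.space) (phi : nat -> car X -> R).
Hypothesis cX : coordinates X phi.

Lemma bcont_bumps L : bcont X (bumps phi L).
Proof.
split; first by have [M hM] := bumps_bounded phi L; exists M.
move=> V oV; apply/(cX.1 _); split; first by move=> x [].
move=> x [Dx Vx].
have [e /= e0 he] : exists2 e : R, 0 < e & ball (bumps phi L x) e `<=` V.
  by have /nbhs_ballP := open_nbhs_nbhs (conj oV Vx).
have := @coord_continuous_bumps _ (dom X) phi L x e Dx e0.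
apply: coord_nbhd_sub => y [hy Dy]; split => //; apply: he.
by rewrite /ball /= distrC.
Qed.

Lemma bcont_bounded_borel f : bcont X f -> bounded_borel X f.
Proof.
move=> [[M hM] fo]; split; last by exists M.
apply: borel_fun_rays => a; apply: (borelsets_open cX).
have := fo [set y | a < y]; apply; exact: open_gt.
Qed.

Lemma bumps_bounded_borel L : bounded_borel X (bumps phi L).
Proof. exact: bcont_bounded_borel (bcont_bumps L). Qed.

Definition lsc (f : car X -> R) : Prop :=
  forall a : R, opens X [set x | dom X x /\ a < f x].

(** Take a rational q strictly between f x - e and f x - e/2, and a rational box around x on which f
    exceeds f x - e/2. The depth at x is positive, so a large multiple M of it exceeds q and the
    bump equals q at x. Elsewhere in the box the bump is at most q if positive, hence below f;
    outside the depth is nonpositive and the bump is 0. *)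
Lemma bump_approx f x (e : R) : lsc f -> (forall y, dom X y -> 0 <= f y) -> dom X x ->
  0 < e -> exists c, (forall y, dom X y -> bump phi c y <= f y) /\ f x - e < bump phi c x.
Proof.
move=> lf f0 Dx e0.
have [|q [q1 q2]] := @rat_between (f x - e) (f x - e / 2); first lra.
have [n [d [d0 hd]]] : coord_nbhd (dom X) phi x [set y | dom X y /\ f x - e / 2 < f y].
  by apply: (coordinates_nbhd cX (lf _)); split => //; lra.
have /choice[a ha] : forall k, exists r, phi k x - d < ratR r /\ ratR r < phi k x.
  by move=> k; apply: rat_between; lra.
have /choice[b hb] : forall k, exists r, phi k x < ratR r /\ ratR r < phi k x + d.
  by move=> k; apply: rat_between; lra.
pose l := [seq (k, a k, true) | k <- iota 0 n] ++ [seq (k, b k, false) | k <- iota 0 n].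
have lx : 0 < box_depth phi l x.
  rewrite box_depth_gt0 all_cat !all_map; apply/andP; split; apply/allP => k _ /=;
    rewrite /half_space /= subr_gt0; [exact: (ha k).2|exact: (hb k).1].
have ly y : dom X y -> 0 < box_depth phi l y -> f x - e / 2 < f y.
  move=> Dy; rewrite box_depth_gt0 all_cat !all_map => /andP[/allP h1 /allP h2].
  apply: (hd y Dy _).2 => k kn; have kI : k \in iota 0 n by rewrite mem_iota.
  have := h1 k kI; have := h2 k kI; rewrite /= /half_space /= => h3 h4.
  by apply/ltr_normlP; have := ha k; have := hb k; split; lra.
pose M := Num.bound (`|ratR q| / box_depth phi l x).
have hM : ratR q < M%:R * box_depth phi l x.
  rewrite -ltr_pdivrMr//; apply: (@le_lt_trans _ _ (`|ratR q| / box_depth phi l x)).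
    by rewrite ler_pM2r ?invr_gt0// ler_norm.
  by apply: archi_boundP; rewrite divr_ge0// ltW.
exists (q, M, l); rewrite /bump /=; split; last first.
  by rewrite lt_max lt_min q1 (lt_trans q1 hM) orbT.
move=> y Dy; rewrite ge_max f0//= ge_min.
case: (ltP 0 (box_depth phi l y)) => h.
  by rewrite ltW// (lt_trans q2)//; exact: ly.
by apply/orP; right; apply: le_trans (f0 y Dy); rewrite mulr_ge0_le0.
Qed.

(** [Ls n] lists the codes among the first n whose bump lies below f. By [bump_approx] the maxima
    over these lists increase to f, and monotone convergence gives one with expectation above a. *)
Lemma bumps_expect_gt mu f (a : R) : is_prob X mu -> bounded_borel X f -> lsc f ->
  (forall y, dom X y -> 0 <= f y) -> a < expect X mu f ->
  exists L, (forall y, dom X y -> bumps phi L y <= f y) /\ a < expect X mu (bumps phi L).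
Proof.
move=> pmu bf lf f0 af.
pose good (c : bump_code) := forall y, dom X y -> bump phi c y <= f y.
pose Ls := fix Ls n : seq bump_code := if n is m.+1 then
  if unpickle m is Some c then if `[< good c >] then c :: Ls m else Ls m else Ls m else [::].
have LsE n : Ls n.+1 = if unpickle n is Some c then
  if `[< good c >] then c :: Ls n else Ls n else Ls n by [].
have LsS n y : bumps phi (Ls n) y <= bumps phi (Ls n.+1) y.
  by rewrite /=; case: unpickle => // c; case: asboolP => //= _; rewrite le_max lexx orbT.
have Lsf n y : dom X y -> bumps phi (Ls n) y <= f y.
  move=> Dy; elim: n => [|n IH] /=; first exact: f0.
  by case: unpickle => // c; case: asboolP => //= gc; rewrite ge_max IH andbT; exact: gc.
have [||||||n hn] := @expect_gt_sup X phi cX mu pmu (fun n => bumps phi (Ls n)) f a _ _ _ _ _ _ af.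
- by move=> n; exact: bumps_bounded_borel.
- exact: bf.
- by move=> n x _; exact: bumps_ge0.
- by move=> n x _; exact: LsS.
- exact: Lsf.
- move=> x e Dx e0; have [c [gc hc]] := bump_approx lf f0 Dx e0.
  by exists (pickle c).+1; rewrite LsE pickleK asboolT// bumps_cons lt_max hc.
by exists (Ls n); split => //; exact: Lsf.
Qed.

Lemma indic_bounded_borel U : borelsets X U -> bounded_borel X (\1_U : car X -> R).
Proof.
move=> BU; split; last first.
  by exists 1 => x _; rewrite indicE; case: (x \in U); rewrite ?normr1 ?normr0.
apply: borel_fun_rays => a; case: (ltP a 0) => a0.
  have := borelsetsT X; congr borelsets; apply/seteqP; split=> x //; last by case.
  by move=> Dx; split => //; rewrite indicE; apply: lt_le_trans a0 _.
case: (ltP a 1) => a1.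
  have := BU; congr borelsets; apply/seteqP; split=> x.
    by move=> Ux; split; [exact: BU.2|rewrite indicE mem_set].
  by move=> [_]; rewrite indicE; case: (pselect (U x)) => // nU; rewrite memNset// ltNge a0.
have := borelsets0 X; congr borelsets; apply/seteqP; split=> x //.
move=> [_]; rewrite indicE ltNge => /negP[].
by apply: le_trans a1; case: (x \in U).
Qed.

Lemma indic_lsc U : opens X U -> lsc (\1_U : car X -> R).
Proof.
move=> oU a; case: (ltP a 0) => a0.
  have := coordinates_openT cX; congr opens; apply/seteqP; split=> x //; last by case.
  by move=> Dx; split => //; rewrite indicE; apply: lt_le_trans a0 _.
case: (ltP a 1) => a1.
  have := oU; congr opens; apply/seteqP; split=> x.
    by move=> Ux; split; [exact: (coordinates_dom cX oU)|rewrite indicE mem_set].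
  by move=> [_]; rewrite indicE; case: (pselect (U x)) => // nU; rewrite memNset// ltNge a0.
apply/(cX.1 _); split; first by move=> x [].
move=> x [_]; rewrite indicE ltNge => /negP[].
by apply: le_trans a1; case: (x \in U).
Qed.

Lemma expect_indic mu U : is_prob X mu -> borelsets X U ->
  (expect X mu (\1_U : car X -> R))%:E = mu U.
Proof.
by move=> pmu BU; rewrite -(pint_expect cX pmu (indic_bounded_borel BU)) (pint_indic cX pmu BU).
Qed.

(** The indicator of an open set is lower semicontinuous, hence a supremum of bump maxima, so the
    measures agree on the pi-system of open sets. *)
Lemma is_prob_eq_bumps mu nu : is_prob X mu -> is_prob X nu ->
  (forall L, expect X mu (bumps phi L) = expect X nu (bumps phi L)) -> mu = nu.
Proof.
move=> pm pn h.
apply: (is_prob_eq cX (setI_closed_opens cX)) => //.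
- by move=> U; exact: (borelsets_open cX).
- by move=> E [].
move=> U oU; have BU := borelsets_open cX oU.
rewrite -(expect_indic pm BU) -(expect_indic pn BU); congr _%:E.
wlog suff : mu nu pm pn h / expect X mu \1_U <= expect X nu \1_U.
  by move=> w; apply/eqP; rewrite eq_le !w.
rewrite leNgt; apply/negP => lt.
have [L [hL]] := bumps_expect_gt pm (indic_bounded_borel BU) (indic_lsc oU)
  (fun y _ => ltac:(by rewrite indicE)) lt.
rewrite h ltNge => /negP; apply.
exact: (expect_le cX pn (bumps_bounded_borel L) (indic_bounded_borel BU) hL).
Qed.

Definition delta_coord (i : nat) (mu : set (car X) -> \bar R) : R :=
  if unpickle i is Some L then expect X mu (bumps phi L) else 0.

Lemma delta_coord_pickle L mu : delta_coord (pickle L) mu = expect X mu (bumps phi L).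
Proof. by rewrite /delta_coord pickleK. Qed.

Lemma bcont_affine_lsc f (a b : R) : bcont X f -> lsc (fun x => a * f x + b).
Proof.
move=> [_ fo] c; have := fo [set y | c < a * y + b].
apply; apply: (@open_comp _ _ (fun y : R => a * y + b) [set y | c < y]); last exact: open_gt.
move=> y _; apply: (@cvgD R R^o); last exact: cvg_cst.
by apply: (@cvgM R); [exact: cvg_cst|exact: cvg_id].
Qed.

Lemma affine_bounded_borel f (a b : R) : bcont X f -> bounded_borel X (fun x => a * f x + b).
Proof.
move=> cf; split.
  by apply: borel_fun_rays => c; apply: (borelsets_open cX); exact: bcont_affine_lsc.
have [[M hM] _] := cf; exists (`|a| * M + `|b|) => x Dx.
by apply: le_trans (ler_normD _ _) _; rewrite lerD2r normrM ler_wpM2l// hM.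
Qed.

(* Half of the continuity of mu |-> \int f dmu, applied below to f + M and M - f. *)
Lemma expect_lsc mu f (a b e : R) : is_prob X mu -> bcont X f ->
  (forall x, dom X x -> 0 <= a * f x + b) -> 0 < e ->
  coord_nbhd (is_prob X) delta_coord mu
    [set nu | a * expect X mu f - e < a * expect X nu f].
Proof.
move=> pm cf f0 e0; have bf := affine_bounded_borel a b cf.
have [|L [hL1 hL2]] := @bumps_expect_gt mu _ (expect X mu (fun x => a * f x + b) - e / 2) pm bf
    (bcont_affine_lsc a b cf) f0; first by lra.
exists (pickle L).+1, (e / 2); split; first by rewrite divr_gt0.
move=> nu pn /(_ _ (ltnSn _)); rewrite !delta_coord_pickle => /ltr_normlP[h1 h2] /=.
have := expect_le cX pn (bumps_bounded_borel L) bf hL1.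
have cb := bcont_bounded_borel cf.
move: hL2; rewrite (expect_affine cX pm a b cb) (expect_affine cX pn a b cb); lra.
Qed.

(** A bounded continuous f is approached from below by bump maxima after adding a constant, and so
    is -f. Countably many integrals therefore control all those that define the weak topology. *)
Lemma delta_coordinates : coordinates (Delta X) delta_coord.
Proof.
split; last first.
  move=> mu nu pm pn h; apply: is_prob_eq_bumps => // L.
  by rewrite -!delta_coord_pickle.
apply: gen_topE.
  move=> _ mu [f [V [cf oV ->]]] pm Vmu.
  have [e /= e0 he] : exists2 e : R, 0 < e & ball (expect X mu f) e `<=` V.
    by have /nbhs_ballP := open_nbhs_nbhs (conj oV Vmu).
  have [[M hM] _] := cf.
  have h1 := @expect_lsc mu f 1 M e pm cf _ e0.
  have h2 := @expect_lsc mu f (-1) M e pm cf _ e0.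
  (* The signs 1 and -1 give the lower and the upper estimate of the integral of f; M makes both
     functions nonnegative. *)
  have hk k : (k < 2)%N -> coord_nbhd (is_prob X) delta_coord mu
      [set nu | (if k == 0%N then 1 else -1) * expect X mu f - e <
        (if k == 0%N then 1 else -1) * expect X nu f].
    case: k => [|k] _; [apply: h1|apply: h2] => x Dx;
      have := hM x Dx; rewrite ler_norml => /andP[]; lra.
  have := coord_nbhd_fin hk; apply: coord_nbhd_sub => nu [hnu pn]; apply: he.
  rewrite /ball /=; have := hnu 0%N isT; have := hnu 1%N isT => /= k1 k2.
  by apply/ltr_normlP; split; rewrite /expect in k1 k2 *; lra.
move=> i mu e pm e0; rewrite /delta_coord; case: (unpickle i) => [L|]; last first.
  by exists 0%N, (fun=> setT); split => // y _ _ /=; rewrite subrr normr0.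
exists 1%N, (fun=> [set nu | ball (expect X mu (bumps phi L)) e (fine (pint X nu (bumps phi L)))]).
split.
  move=> _ _; split; last by apply: ballxx.
  exists (bumps phi L), (ball (expect X mu (bumps phi L)) e); split => //.
    exact: bcont_bumps.
  exact: (@ball_open R R^o).
by move=> nu pn /(_ 0%N isT); rewrite /ball /= distrC.
Qed.

End LowerSemicontinuous.

(** * Spaces of conditional probability systems *)

Section ConditionalProbabilitySystems.
Variables (X : Defs.space) (phi : nat -> car X -> R) (J : Type) (c : J -> set (car X)).
Variable dec : nat -> option J.
Hypotheses (cX : coordinates X phi) (decP : forall k, exists a, dec a = Some k).

Definition cps_coord (i : nat) (mu : J -> set (car X) -> \bar R) : R :=
  if unpickle i is Some (a, L) then
    if dec a is Some k then expect X (mu k) (bumps phi (L : seq bump_code)) else 0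
  else 0.

Lemma cps_coord_pickle a L k mu : dec a = Some k ->
  cps_coord (pickle (a, L : seq bump_code)) mu = expect X (mu k) (bumps phi L).
Proof. by move=> h; rewrite /cps_coord pickleK h. Qed.

(** A countable product of spaces of measures: a coordinate is coded by a conditioning event,
    enumerated by [dec], and a list of bumps. *)
Lemma cps_coordinates : coordinates (cps_space X c) cps_coord.
Proof.
have cD := delta_coordinates cX.
split; last first.
  move=> mu nu [pm _ _] [pn _ _] h; apply/funext => k.
  apply: (is_prob_eq_bumps cX (pm k) (pn k)) => L.
  by have [a ha] := decP k; rewrite -!(cps_coord_pickle L _ ha).
apply: gen_topE.
  move=> _ mu [k [U [oU ->]]] [pm _ _] Umu.
  have [n [e [e0 hn]]] := coordinates_nbhd cD oU Umu.
  have [a ha] := decP k.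
  (* Translates index i of a coordinate of the k-th measure into a bound on its index for the whole
     system; the maximum over i < n covers all the coordinates involved. *)
  pose N (i : nat) := if unpickle i is Some L then (pickle (a, L : seq bump_code)).+1 else 0%N.
  exists (\max_(i < n) N i)%N, e; split => // nu [pn _ _] hnu /=.
  apply: (hn _ (pn k)) => i ni; rewrite /delta_coord.
  have := @leq_bigmax _ (fun i : 'I_n => N i) (Ordinal ni); rewrite /N [_ (Ordinal ni)]/=.
  case: (unpickle i) => [L|] hL; last by rewrite subrr normr0.
  by rewrite -!(cps_coord_pickle L _ ha); exact: hnu.
move=> i mu e [pm _ _] e0; rewrite /cps_coord.
have triv : gen_nbhd (is_cps X c) [set W | exists k U, opens (Delta X) U /\
    W = [set mu | U (mu k)]] mu [set y : J -> set (car X) -> \bar R | `|0 - 0 : R| < e].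
  by exists 0%N, (fun=> setT); split => // y _ _ /=; rewrite subrr normr0.
case: (unpickle i) => [[a L]|] //; case: (dec a) => [k|] //.
pose U := [set nu | dom (Delta X) nu /\
  `|delta_coord phi (pickle (L : seq bump_code)) nu - delta_coord phi (pickle L) (mu k)| < e].
exists 1%N, (fun=> [set nu | U (nu k)]); split.
  move=> _ _; split; last by split; [exact: pm|rewrite subrr normr0].
  exists k, U; split => //.
  exact: (coordinates_open_lt (pickle (L : seq bump_code)) cD (pm k) e0).
move=> nu [pn _ _] /(_ 0%N isT) [_].
by rewrite !delta_coord_pickle.
Qed.

End ConditionalProbabilitySystems.

Lemma marg_cps (X Y : Defs.space) (J : Type) (c : J -> set (car X)) (c' : J -> set (car Y))
  (f : car X -> car Y) mu : borel_map X Y f -> (forall k, borelsets Y (c' k)) ->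
  (forall k, f @^-1` c' k `&` dom X = c k) -> is_cps X c mu ->
  is_cps Y c' (marg Y X f mu).
Proof.
move=> fm Bc' fc [m1 m2 m3]; split.
- by move=> k; apply: marg_prob fm (m1 k).
- by move=> k; rewrite margE// fc.
move=> A k l BA Ak kl; rewrite !margE// fc; apply: m3; first exact: fm.2.
  by rewrite -fc => x [Ax Dx]; split => //; exact: Ak.
by rewrite -!fc => x [cx Dx]; split => //; exact: kl.
Qed.

Section Kernels.
Variables (W Z : Defs.space) (omega : nat -> car W -> R) (zeta : nat -> car Z -> R).
Hypotheses (cW : coordinates W omega) (cZ : coordinates Z zeta).
Variables (J : Type) (c : J -> set (car Z)) (dec : nat -> option J).
Hypothesis decP : forall k, exists a, dec a = Some k.
Variable b : car W -> J -> set (car Z) -> \bar R.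
Hypothesis mb : borel_map W (cps_space Z c) b.

Let pb t k : dom W t -> is_prob Z (b t k).
Proof. by move=> /mb.1[]. Qed.

Lemma borel_fun_bumps k L : borel_fun W (fun t => expect Z (b t k) (bumps zeta L)).
Proof.
have [a ha] := decP k; have cC := cps_coordinates c cZ decP.
have := borel_fun_comp mb (borel_fun_coord (pickle (a, L)) cC); congr borel_fun.
by apply/funext => t; rewrite /comp (cps_coord_pickle zeta L (b t) ha).
Qed.

Variable k : J.

(** Outside [dom W], where [b] need not return probabilities, the zero measure makes this a family
    of measures indexed by all of [bor W]. *)
Let ker (t : bor W) : {measure set (bor Z) -> \bar R} :=
  match t with
  | Some t' => match pselect (dom W t') with
    | left D => bor_measure cZ (pb k D)
    | right _ => mzero
    end
  | None => mzero
  end.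

Let kerv (A : set (bor Z)) (t : bor W) : \bar R := ker t A.

Let kerE t A : dom W t -> ker (Some t) A = b t k (Some @^-1` A `&` dom Z).
Proof. by rewrite /ker; case: pselect. Qed.

Let ker0 t A : ~ dom_bor (X:=W) t -> ker t A = 0%E.
Proof.
case: t => [t|] //= nD; case: pselect => // D; case: nD; by exists t.
Qed.

(** The mass of U exceeds r exactly when one of countably many bump maxima below the indicator has
    expectation above r, and those expectations are Borel in t. The second set handles the zero
    measure. *)
Let measurable_ker_open U : opens Z U ->
  measurable_fun [set: bor W] (kerv (Some @` U)).
Proof.
move=> oU; have BU := borelsets_open cZ oU.
apply: (measurability _ (ErealGenOInfty.measurableE R)) => _ [_ [r ->] <-].
rewrite setTI.
pose F (L : seq bump_code) := if `[< forall z, dom Z z -> bumps zeta L z <= \1_U z >]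
  then [set t | dom W t /\ r < expect Z (b t k) (bumps zeta L)] else set0.
have -> : kerv (Some @` U) @^-1` `]r%:E, +oo[ =
    (Some @` [set t | exists L, F L t]) `|` (if r < 0 then ~` (dom_bor (X:=W)) else set0).
  apply/seteqP; split=> t; rewrite /preimage /kerv /= in_itv /= andbT.
    have [[t' Dt <-]|nD] := pselect (dom_bor (X:=W) t); last first.
      by rewrite ker0// lte_fin => ->; right.
    rewrite kerE// => h; left; exists t' => //.
    have := h; rewrite (_ : _ `&` _ = U); last first.
      apply/seteqP; split=> x; first by move=> [[y Uy [<-]]].
      by move=> Ux; split; [exists x|exact: BU.2].
    rewrite -(expect_indic cZ (pb k Dt) BU) lte_fin => rlt.
    have [L [hL1 hL2]] := bumps_expect_gt cZ (pb k Dt) (indic_bounded_borel BU)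
      (indic_lsc cZ oU) (fun y _ => ltac:(by rewrite indicE)) rlt.
    by exists L; rewrite /F asboolT.
  move=> [[t' [L]] + <-|]; last first.
    by case: ifP => // r0 nD; rewrite ker0// lte_fin.
  rewrite /F; case: asboolP => // hL [Dt hr]; rewrite kerE//.
  rewrite (_ : _ `&` _ = U); last first.
    apply/seteqP; split=> x; first by move=> [[y Uy [<-]]].
    by move=> Ux; split; [exists x|exact: BU.2].
  rewrite -(expect_indic cZ (pb k Dt) BU) lte_fin; apply: lt_le_trans hr _.
  exact: (expect_le cZ (pb k Dt) (bumps_bounded_borel cZ L) (indic_bounded_borel BU) hL).
apply: measurableU.
  apply: (measurable_bor cW); apply: borelsets_bigcup_count => L; rewrite /F.
  case: asboolP => _; last exact: borelsets0.
  have := borel_fun_bumps k L (measurable_itv `]r, +oo[); congr borelsets.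
  by apply/seteqP; split=> t /=; rewrite in_itv /= andbT.
by case: ifP => // _; apply: measurableC; exact: (measurable_dom_bor cW).
Qed.

(** Dynkin induction from the open sets; finite total mass permits the subtraction needed for
    complements. *)
Let measurable_ker A : measurable A -> measurable_fun [set: bor W] (kerv A).
Proof.
have kfin t : (ker t setT < +oo)%E.
  have [[t' Dt <-]|nD] := pselect (dom_bor (X:=W) t); last by rewrite ker0// ltry.
  by rewrite kerE// (le_lt_trans (is_prob_le1 _ cZ (pb k Dt))) ?ltry.
have mT : measurable_fun [set: bor W] (kerv setT).
  rewrite (_ : kerv setT = kerv (Some @` dom Z)).
    apply: measurable_ker_open; exact: (coordinates_openT cZ).
  apply/funext => t; rewrite /kerv.
  have [[t' Dt <-]|nD] := pselect (dom_bor (X:=W) t); last by rewrite !ker0.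
  rewrite !kerE//; congr (b _ _ _); apply/seteqP; split=> x; last by move=> [].
  by move=> [_ Dx]; split => //; exists x.
apply: (@dynkin_induction _ (bor Z) [set Some @` U | U in opens Z]
  [set A | measurable_fun [set: bor W] (kerv A)]) => //=.
- move=> _ _ [U oU <-] [V oV <-]; exists (U `&` V); first exact: (setI_closed_opens cZ).
  apply/seteqP; split; first by move=> _ [x [Ux Vx] <-]; split; exists x.
  by move=> _ [[x Ux <-] [y Vy [yx]]]; exists x => //; split => //; rewrite -yx.
- by move=> _ [U oU <-]; exact: measurable_ker_open.
- move=> S mS mS'.
  rewrite (_ : kerv _ = (fun t => kerv setT t - kerv S t)%E).
    exact: emeasurable_funB.
  apply/funext => t; rewrite /kerv -setTD measureD//; last exact: kfin.
  by rewrite setTI.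
- move=> F mF tF h.
  rewrite (_ : kerv _ = (fun t => \sum_(0 <= n <oo) kerv (F n) t)%E).
    by apply: ge0_emeasurable_sum.
  apply/funext => t.
  transitivity (\sum_(0 <= n <oo | n \in [set: nat]) kerv (F n) t)%E.
    by apply: (measure_bigcup (ker t)) => // n _; exact: mF.
  by apply: eq_eseriesl => n; rewrite in_setT.
Qed.

(** Borel measurability into the weak topology, given through bumps, here reaches arbitrary
    nonnegative bounded Borel integrands. *)
Lemma borel_fun_expect g : bounded_borel Z g -> (forall z, dom Z z -> 0 <= g z) ->
  borel_fun W (fun t => expect Z (b t k) g).
Proof.
move=> bg g0 V mV.
have m1 : measurable_fun [set: bor W] (fun t => \int[ker t]_z (bor_fun g z)%:E)%E.
  apply: measurable_fun_integral_kernel => //.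
    by move=> [z|]; rewrite lee_fin //=; case: asboolP => // Dz; exact: g0.
  by apply/measurable_EFinP; exact: (measurable_bor_fun cZ bg.1).
have := borelsets_bor cW (m1 measurableT _ (measurable_image_EFin mV)).
congr borelsets; rewrite setTI; apply/seteqP; split=> t.
  move=> [/= [v Vv] + Dt]; rewrite /ker; case: pselect => // D.
  by rewrite -(pintE cZ (pb k D)) (pint_expect cZ (pb k D) bg) => -[<-].
move=> [Dt Vt]; split => //=; exists (expect Z (b t k) g) => //.
rewrite /ker; case: pselect => // D.
by rewrite -(pintE cZ (pb k D)) (pint_expect cZ (pb k D) bg).
Qed.

End Kernels.

(** As f is only Borel, taking images along f need not be weakly continuous. A coordinate of the
    image is the integral of a bump maximum composed with f, a bounded Borel function, so
    [borel_fun_expect] applies. *)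
Lemma borel_map_marg (W Z Y : Defs.space) omega zeta psi (J : Type)
  (c : J -> set (car Z)) (c' : J -> set (car Y)) (dec : nat -> option J)
  (b : car W -> J -> set (car Z) -> \bar R) (f : car Z -> car Y) :
  coordinates W omega -> coordinates Z zeta -> coordinates Y psi ->
  (forall k, exists a, dec a = Some k) ->
  borel_map W (cps_space Z c) b -> borel_map Z Y f ->
  (forall k, borelsets Y (c' k)) -> (forall k, f @^-1` c' k `&` dom Z = c k) ->
  borel_map W (cps_space Y c') (fun t => marg Y Z f (b t)).
Proof.
move=> cW cZ cY decP mb fm Bc' fc.
apply: (borel_map_coord (cps_coordinates c' cY decP)).
  by move=> t Dt; apply: (marg_cps fm Bc' fc); exact: mb.1.
move=> i; rewrite /comp /cps_coord.
have triv : borel_fun W (fun=> 0).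
  apply: borel_fun_rays => a; case: (ltP a 0) => a0.
    by have := borelsetsT W; congr borelsets; apply/seteqP; split=> x //; case.
  by have := borelsets0 W; congr borelsets; apply/seteqP; split=> x //; case.
case: (unpickle i) => [[a L]|] //; case: (dec a) => [k|] //.
have bL : bounded_borel Z (bumps psi L \o f).
  split; first exact: (borel_fun_comp fm (bumps_bounded_borel cY L).1).
  by have [M hM] := bumps_bounded psi L; exists M => z _; exact: hM.
have := borel_fun_expect cW cZ decP mb k bL (fun z _ => bumps_ge0 psi L (f z)).
move=> h V mV; have := h V mV; congr borelsets.
have E t : dom W t -> expect Y (marg Y Z f (b t) k) (bumps psi L) =
    expect Z (b t k) (bumps psi L \o f).
  move=> Dt; rewrite /expect (pint_marg cZ cY fm)//.
  - by have [] := mb.1 t Dt.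
  - exact: (bumps_bounded_borel cY L).1.
  - by move=> y _; exact: bumps_ge0.
by apply/seteqP; split=> t [Dt Vt]; split => //; move: Vt; rewrite E.
Qed.

(** * Hierarchy maps *)

Section Hierarchies.
Variables (S : topologicalType) (Bs : bool -> set (set S)) (phiS : nat -> S -> R).
Hypothesis cS : coordinates (topsp S) phiS.
Hypothesis cBs : forall p, countable (Bs p).
Hypothesis bBs : forall p B, Bs p B -> borelsets (topsp S) B.

Lemma Bidx_enum p : exists dec : nat -> option (Bidx S Bs p),
  forall k, exists a, dec a = Some k.
Proof.
have [e [he _]] := countable_enum (cBs p).
exists (fun a => if e a is Some B then
  if pselect (Bs p B) is left h then Some (exist _ B h) else None else None).
move=> [B hB]; have [a ha] := he B hB; exists a; rewrite ha.
by case: pselect => // h; congr (Some (exist _ _ _)); exact: Prop_irrelevance.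
Qed.

(** Stated for both players at once, because the next space of uncertainty of p is built from the
    hierarchies of the opponent. *)
Definition regular_stage (st : stage S Bs) : Prop := forall p,
  [/\ exists phi, coordinates (Th S Bs st p) phi,
      exists phi, coordinates (Hn S Bs st p) phi,
      borel_map (Th S Bs st p) (topsp S) (prS S Bs st p) &
      borel_map (prod_space (topsp S) (Hn S Bs st (~~ p))) (Th S Bs st p) (rho S Bs st p)].

(** Countability of the conditioning family enters here, through the enumeration of its index
    type. *)
Lemma Cps_coordinates p (Y : Defs.space) pr phi : coordinates Y phi ->
  exists psi, coordinates (Cps S Bs p Y pr) psi.
Proof.
by move=> cY; have [dec decP] := Bidx_enum p; eexists; exact: (cps_coordinates _ cY decP).
Qed.

Lemma regular_stage_n n : regular_stage (stage_n S Bs n).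
Proof.
elim: n => [|n IH] p.
  have [psi cH] := @Cps_coordinates (~~ p) (topsp S) id phiS cS.
  split; [by exists phiS|exact: (Cps_coordinates _ _ cS)| |exact: (borel_map_fst cS cH)].
  by split => // E BE; rewrite preimage_id setIT.
pose Tn q := prod_space (topsp S) (Hn S Bs (stage_n S Bs n) (~~ q)).
have cT q : exists phi, coordinates (Tn q) phi.
  by have [_ [phi cH] _ _] := IH (~~ q); eexists; exact: (prod_coordinates cS cH).
have cP q : exists phi, coordinates (prod_space (Hn S Bs (stage_n S Bs n) q)
    (Cps S Bs q (Tn q) fst)) phi.
  have [_ [phi cH] _ _] := IH q; have [psi1 cTq] := cT q.
  have [psi cC] := @Cps_coordinates q (Tn q) fst _ cTq.
  by eexists; exact: (prod_coordinates cH cC).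
have cH q : exists phi, coordinates (Hn S Bs (stage_n S Bs n.+1) q) phi.
  by have [phi cPq] := cP q; eexists; apply: sub_coordinates; exact: cPq.
have [_ [phiH cHp] _ _] := IH (~~ p).
have [phiP cPp] := cP (~~ p); have [phiH1 cH1p] := cH (~~ p).
split; [exact: cT|exact: cH|exact: (borel_map_fst cS cHp)|].
apply: (borel_map_pair cS cHp); first exact: (borel_map_fst cS cH1p).
have [_ [phi1 c1] _ _] := IH (~~ p); have [psi1 cT1] := cT (~~ p).
have [psi2 cC] := @Cps_coordinates (~~ p) (Tn (~~ p)) fst _ cT1.
exact: (borel_map_comp (borel_map_comp (borel_map_snd cS cH1p)
  (borel_map_sub_incl _ cPp)) (borel_map_fst c1 cC)).
Qed.

Variable T : tstruct S Bs.
Variable tau : forall p, nat -> Ty S Bs T p -> R.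
Hypothesis cT : forall p, coordinates (topsp (Ty S Bs T p)) (@tau p).
Hypothesis hT : is_tstruct S Bs T.

Definition SxTy p : Defs.space := prod_space (topsp S) (topsp (Ty S Bs T (~~ p))).

Lemma SxTy_coordinates p : coordinates (SxTy p) (prod_coord phiS (@tau (~~ p))).
Proof. exact: prod_coordinates cS (cT (~~ p)). Qed.

Lemma dom_SxTy p : dom (SxTy p) = setT.
Proof. by apply/seteqP; split. Qed.

Lemma prS_hminus n p z : prS S Bs (stage_n S Bs n) p (hminus S Bs T n p z) = z.1.
Proof. by case: n. Qed.

Lemma lastb_hier n p t : lastb S Bs (stage_n S Bs n) p (hier S Bs T n p t) = hfull S Bs T p t n.
Proof. by case: n. Qed.

Lemma rho_hminus n p z :
  rho S Bs (stage_n S Bs n) p (hminus S Bs T n.+1 p z) = hminus S Bs T n p z.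
Proof. by case: n. Qed.

Lemma borel_map_beta p :
  borel_map (topsp (Ty S Bs T p)) (Cps S Bs p (SxTy p) fst) (beta S Bs T p).
Proof.
have [_ h1 h2] := hT p; split; first by move=> t _; exact: h1.
by move=> E /h2; rewrite setIT.
Qed.

Lemma conditioning_events n p (k : Bidx S Bs p) :
  borelsets (Theta S Bs n p)
    [set y | dom (Theta S Bs n p) y /\ (proj1_sig k : set S) (prS S Bs (stage_n S Bs n) p y)].
Proof.
have [_ _ mpr _] := regular_stage_n n p.
case: k => [B hB] /=; have := mpr.2 _ (bBs hB); congr borelsets.
by apply/seteqP; split=> y; case.
Qed.

Lemma conditioning_events_hminus n p (k : Bidx S Bs p) :
  borel_map (SxTy p) (Theta S Bs n p) (hminus S Bs T n p) ->
  hminus S Bs T n p @^-1` [set y | dom (Theta S Bs n p) y /\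
      (proj1_sig k : set S) (prS S Bs (stage_n S Bs n) p y)] `&` dom (SxTy p) =
  [set y | dom (SxTy p) y /\ (proj1_sig k : set S) y.1].
Proof.
move=> mh; apply/seteqP; split=> z.
  by move=> [[_ hz] Dz]; split => //; move: hz; rewrite prS_hminus.
by move=> [Dz hz]; split => //; split; [exact: mh.1|rewrite prS_hminus].
Qed.

Lemma borel_map_hfull n p : borel_map (SxTy p) (Theta S Bs n p) (hminus S Bs T n p) ->
  borel_map (topsp (Ty S Bs T p)) (Cps S Bs p (Theta S Bs n p) (prS S Bs (stage_n S Bs n) p))
    (fun t => hfull S Bs T p t n).
Proof.
move=> mh; have [[psi cTh] _ _ _] := regular_stage_n n p.
have [dec decP] := Bidx_enum p.
apply: (borel_map_marg (cT p) (SxTy_coordinates p) cTh decP (borel_map_beta p) mh).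
  by move=> k; exact: conditioning_events.
by move=> k; exact: conditioning_events_hminus.
Qed.

(** The two claims feed each other: [hminus] at n.+1 comes from the opponent's [hier] at n, and
    [hier] at n.+1 adds to that at n the image of [beta] along [hminus] at n.+1. *)
Lemma borel_map_hierarchy n :
  (forall p, borel_map (SxTy p) (Theta S Bs n p) (hminus S Bs T n p)) /\
  (forall p, borel_map (topsp (Ty S Bs T p)) (Hlev S Bs n p) (hier S Bs T n p)).
Proof.
elim: n => [|n [IH1 IH2]].
  have h0 p : borel_map (SxTy p) (Theta S Bs 0 p) (hminus S Bs T 0 p).
    exact: (borel_map_fst cS (cT (~~ p))).
  by split => // p; exact: (borel_map_hfull (h0 p)).
have h1 p : borel_map (SxTy p) (Theta S Bs n.+1 p) (hminus S Bs T n.+1 p).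
  have [_ [phi cH] _ _] := regular_stage_n n (~~ p).
  apply: (borel_map_pair cS cH); first exact: (borel_map_fst cS (cT (~~ p))).
  exact: (borel_map_comp (borel_map_snd cS (cT (~~ p))) (IH2 (~~ p))).
split => // p.
have [[psi cTh] [phi cH] _ mrho] := regular_stage_n n p.
have [[psi1 cTh1] _ _ _] := regular_stage_n n.+1 p.
have [psi2 cC] := @Cps_coordinates p _ (prS S Bs (stage_n S Bs n.+1) p) _ cTh1.
apply: (borel_map_sub (prod_coordinates cH cC)).
  exact: (borel_map_pair cH cC (IH2 p) (borel_map_hfull (h1 p))).
(* What remains is the coherence of the last two beliefs: forgetting a level after [hminus] at n.+1
   is [hminus] at n. *)
move=> t _; rewrite /= lastb_hier.
rewrite (marg_marg (X := SxTy p) (Y := Theta S Bs n.+1 p) _ (h1 p).1 mrho).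
by apply: eq_marg => z _; exact: rho_hminus.
Qed.

End Hierarchies.

(** * Souslin spaces as images of closed subsets of the Baire space *)

Lemma half_pow_lt (e : R) : 0 < e -> exists n, 2^-1 ^+ n < e.
Proof.
move=> e0; have e1 : 0 < e^-1 by rewrite invr_gt0.
have [n hn] : exists n : nat, e^-1 < 2 ^+ n.
  exists (Num.bound e^-1); apply: (lt_trans (archi_boundP (ltW e1))).
  by rewrite -natrX ltr_nat ltn_expl.
have p0 : 0 < 2 ^+ n :> R by rewrite exprn_gt0.
by exists n; rewrite exprVn -(invrK e) ltf_pV2 ?posrE.
Qed.

(** A digit sequence u names the points e(u n) of a dense sequence of P, and K asks that successive
    points be within 2^-n. Such a sequence converges by completeness, its limit is within 2 * 2^-n
    of the n-th point, and approximating p to within 2^-(n+2) at each n shows that every p is a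
    limit. The point x0 guarantees that P is inhabited. *)
Lemma rep_souslin (X : topologicalType) phi (x0 : X) :
  coordinates (topsp X) phi -> souslin X -> exists K g, rep phi K g.
Proof.
move=> cX [P [d [[d0 dE dC dT] dcompl [D [cD dense]] [f [fc fs]]]]].
have [p0 _] := fs x0.
have [c [hc _]] := countable_enum cD.
pose e n := odflt p0 (c n).
have edense x (r : R) : 0 < r -> exists n, d x (e n) < r.
  move=> r0; have [y Dy dy] := dense x r r0; have [n hn] := hc y Dy.
  by exists n; rewrite /e hn.
have dxx x : d x x = 0 by apply/dE.
pose w n : R := 2^-1 ^+ n.
have w0 n : 0 < w n by rewrite exprn_gt0.
have wS n : w n = w n.+1 + w n.+1 by rewrite /w exprS; lra.
have w_anti m n : (m <= n)%N -> w n <= w m.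
  move=> mn; rewrite -(subnKC mn); elim: (n - m)%N => [|j IH]; first by rewrite addn0.
  by rewrite addnS; apply: le_trans _ IH; have := wS (m + j)%N; have := w0 (m + j).+1; lra.
pose K := [set u : nat -> nat | forall n, d (e (u n)) (e (u n.+1)) <= w n].
pose conv u x := forall n, d (e (u n)) x <= w n + w n.
(* Partial sums of the geometric series: as w n = 2 w (n+1), the sum of w from n to n + m - 1 is 2 w
   n - 2 w (n + m). *)
have tele u n m : K u -> d (e (u n)) (e (u (n + m)%N)) <= w n + w n - (w (n + m)%N + w (n + m)%N).
  move=> Ku; elim: m => [|m IH]; first by rewrite addn0 dxx subrr.
  have := dT (e (u n)) (e (u (n + m)%N)) (e (u (n + m).+1)).
  by rewrite addnS; have := Ku (n + m)%N; have := wS (n + m)%N; lra.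
have Kconv u : K u -> exists x, conv u x.
  move=> Ku; have [|x hx] := dcompl (e \o u).
    move=> r r0; have [N hN] := half_pow_lt (divr_gt0 r0 (ltr0n _ 4)).
    exists N => m n Nm Nn /=.
    have := tele u N (m - N)%N Ku; have := tele u N (n - N)%N Ku; rewrite !subnKC//.
    have := dT (e (u m)) (e (u N)) (e (u n)); rewrite (dC (e (u m)) (e (u N))).
    have := w0 m; have := w0 n; rewrite -/(w N) in hN; lra.
  exists x => n; rewrite leNgt; apply/negP => lt.
  have [|N hN] := hx (d (e (u n)) x - (w n + w n)); first by rewrite subr_gt0.
  have := hN (maxn n N) (leq_maxr _ _); have := tele u n (maxn n N - n)%N Ku.
  rewrite subnKC ?leq_maxl//= => h1 h2.
  by have := dT (e (u n)) (e (u (maxn n N))) x; have := w0 (maxn n N); lra.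
have /choice[L hL] : forall u, exists x, K u -> conv u x.
  move=> u; have [Ku|nK] := pselect (K u); last by exists p0.
  by have [x hx] := Kconv u Ku; exists x.
exists K, (f \o L); split.
- move=> u hu n; have [v Kv av] := hu n.+2.
  by rewrite (av n) ?(av n.+1)//; exact: Kv.
- move=> x; have [p fp] := fs x.
  have /choice[u hu] : forall n, exists k, d p (e k) < w n.+2.
    by move=> n; apply: edense.
  have Ku : K u.
    move=> n; have := dT (e (u n)) p (e (u n.+1)); rewrite (dC (e (u n)) p).
    have := hu n; have := hu n.+1; have := wS n; have := wS n.+1; have := wS n.+2.
    by have := w0 n.+3; lra.
  exists u => //=; rewrite -fp; congr f; apply/dE/eqP; rewrite eq_le d0 andbT leNgt.
  apply/negP => lt; have [n hn] := half_pow_lt (divr_gt0 lt (ltr0n _ 4)).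
  have := hL u Ku n; have := hu n; have := dT (L u) (e (u n)) p.
  rewrite (dC (L u) (e (u n))) (dC (e (u n)) p); have := wS n; have := wS n.+1.
  by rewrite -/(w n) in hn; have := w0 n.+2; lra.
- move=> k u r Ku r0.
  have oU := coordinates_open_lt k cX (I : dom (topsp X) (f (L u))) r0.
  have [|s s0 hs] := fc _ oU (L u); first by split => //=; rewrite subrr normr0.
  have [n hn] := half_pow_lt (divr_gt0 s0 (ltr0n _ 4)).
  (* Agreement on n.+1 digits fixes e(u n), which is within 2 w n of both limits; hence w n was
     taken below s/4. *)
  exists n.+1 => v Kv av; apply: (hs (L v) _).2 => /=.
  have := hL u Ku n; have := hL v Kv n; rewrite -(av n)//.
  have := dT (L u) (e (u n)) (L v); rewrite (dC (L u) (e (u n))); rewrite -/(w n) in hn; lra.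
Qed.

Lemma rep_pair (X Y : Type) (phi : nat -> X -> R) (psi : nat -> Y -> R) K1 g1 K2 g2 :
  rep phi K1 g1 -> rep psi K2 g2 ->
  exists K g, rep (prod_coord phi psi) K g.
Proof.
move=> [c1 s1 m1] [c2 s2 m2].
pose ev (w : nat -> nat) k := w k.*2; pose od (w : nat -> nat) k := w k.*2.+1.
have evA n u v : agree n.*2 u v -> agree n (ev u) (ev v).
  by move=> h k kn; apply: h; rewrite ltn_double.
have odA n u v : agree n.*2 u v -> agree n (od u) (od v).
  by move=> h k kn; apply: h; rewrite ltn_Sdouble.
exists [set w | K1 (ev w) /\ K2 (od w)], (fun w => (g1 (ev w), g2 (od w))); split.
- move=> u hu; split; [apply: c1|apply: c2] => n; have [v [Kv1 Kv2] av] := hu n.*2.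
    by exists (ev v) => //; exact: evA.
  by exists (od v) => //; exact: odA.
- move=> [x y]; have [u Ku gu] := s1 x; have [v Kv gv] := s2 y.
  pose w k := if odd k then v k./2 else u k./2.
  have ew : ev w = u by apply/funext => k; rewrite /ev /w odd_double doubleK.
  have ow : od w = v by apply/funext => k; rewrite /od /w /= odd_double /= uphalf_double.
  by exists w; [split; rewrite ?ew ?ow|rewrite ew ow gu gv].
- move=> k u e [Ku Kv] e0; rewrite /prod_coord /=; case: (odd k).
    have [n hn] := m2 k./2 _ e Kv e0; exists n.*2 => v [Kv1 Kv2] av.
    by apply: hn => //; exact: odA.
  have [n hn] := m1 k./2 _ e Ku e0; exists n.*2 => v [Kv1 Kv2] av.
  by apply: hn => //; exact: evA.
Qed.

(** * Beliefs determined by their marginals on the hierarchy spaces *)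

Section Determination.
Variables (S : topologicalType) (Bs : bool -> set (set S)) (phiS : nat -> S -> R).
Hypothesis cS : coordinates (topsp S) phiS.
Hypothesis cBs : forall p, countable (Bs p).
Hypothesis bBs : forall p B, Bs p B -> borelsets (topsp S) B.
Variable T : tstruct S Bs.
Variable tau : forall p, nat -> Ty S Bs T p -> R.
Hypothesis cT : forall p, coordinates (topsp (Ty S Bs T p)) (@tau p).
Hypothesis hT : is_tstruct S Bs T.
Hypothesis sS : souslin S.
Hypothesis sT : souslin_ts S Bs T.
Hypothesis nT : non_redundant S Bs T.
Variable p : bool.

Let Z := SxTy T p.

Definition hierarchy_sets : set (set (car Z)) :=
  [set A | exists n E, borelsets (Theta S Bs n p) E /\
    A = hminus S Bs T n p @^-1` E `&` dom Z].

Let mh n : borel_map Z (Theta S Bs n p) (hminus S Bs T n p).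
Proof. exact: (borel_map_hierarchy cS cBs bBs cT hT n).1. Qed.

(** Pulling back along [rho] turns a condition on a low level into one on a higher level, so the
    levels are nested and two sets can be intersected at a common one. *)
Lemma hierarchy_sets_le m n E : (m <= n)%N -> borelsets (Theta S Bs m p) E ->
  exists2 E', borelsets (Theta S Bs n p) E' &
    hminus S Bs T m p @^-1` E `&` dom Z = hminus S Bs T n p @^-1` E' `&` dom Z.
Proof.
move=> mn BE; rewrite -(subnKC mn); elim: (n - m)%N => [|j [E' BE' ->]].
  by rewrite addn0; exists E.
have [_ _ _ mrho] := regular_stage_n cS cBs (m + j) p.
rewrite addnS; eexists; first exact: (mrho.2 _ BE').
apply/seteqP; split=> z [hz Dz]; split => //.
  split; last exact: ((mh (m + j).+1).1 z Dz).
  by rewrite /preimage /= rho_hminus.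
by move: hz => [+ _]; rewrite /preimage /= rho_hminus.
Qed.

Lemma setI_closed_hierarchy_sets : setI_closed hierarchy_sets.
Proof.
move=> _ _ [m [E [BE ->]]] [n [F [BF ->]]].
have [E' BE' ->] := hierarchy_sets_le (leq_maxl m n) BE.
have [F' BF' ->] := hierarchy_sets_le (leq_maxr m n) BF.
exists (maxn m n), (E' `&` F'); split; first exact: borelsetsI.
by apply/seteqP; split=> z; [move=> [[? ?] [? _]]|move=> [[? ?] ?]].
Qed.

(** Level 0 gives the state. Level n.+1 gives the hierarchy of the type up to its belief on level n,
    and all these beliefs together determine the type by non-redundancy. *)
Lemma hminus_separates z z' :
  (forall n, hminus S Bs T n p z = hminus S Bs T n p z') -> z = z'.
Proof.
case: z z' => [s t] [s' t'] h; have /= -> := h 0%N.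
suff -> : t = t' by [].
apply: nT; apply: functional_extensionality_dep => n.
rewrite -!lastb_hier; congr lastb.
by have [] := h n.+1.
Qed.

(** Blackwell's theorem on Z, parametrized by pairing digit sequences for S and for the opponent's
    types; z0 supplies the points needed to parametrize them. *)
Lemma borelsets_hierarchy (z0 : car Z) : borelsets Z `<=` <<s dom Z, hierarchy_sets >>.
Proof.
have hth n : {th | coordinates (Theta S Bs n p) th}.
  by apply: cid; have [? _ _ _] := regular_stage_n cS cBs n p.
pose theta n := projT1 (hth n).
have cTh n : coordinates (Theta S Bs n p) (theta n) := projT2 (hth n).
have [K1 [g1 r1]] := rep_souslin z0.1 cS sS.
have [K2 [g2 r2]] := rep_souslin z0.2 (cT (~~ p)) (sT (~~ p)).
have [K [g r]] := rep_pair r1 r2.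
have cZ : coordinates Z _ := SxTy_coordinates cS cT p.
(* Rational half-lines in the coordinates of each level form the countable family: values of
   [theta n k] that differ are split by some rational q. *)
pose A n k q := [set y | dom (Theta S Bs n p) y /\ theta n k y < ratR q].
have BA n k q : borelsets (Theta S Bs n p) (A n k q).
  have h := borel_fun_coord k (cTh n) (measurable_itv `]-oo, ratR q[).
  rewrite (_ : A n k q = [set y | dom (Theta S Bs n p) y /\
    [set` `]-oo, ratR q[] (theta n k y)]); first exact: h.
  by apply/seteqP; split=> y; rewrite /A /= in_itv.
pose Cs m : set (car Z) := if unpickle m is Some (n, k, q)
  then hminus S Bs T n p @^-1` A n k q `&` dom Z else set0.
have dZ : dom Z = setT := dom_SxTy T p.
have sub : <<s opens Z >> `<=` <<s range Cs >>.
  apply: (blackwell _ _ r).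
  - move=> x y h; exact: (cZ.2 x y).
  - move=> U oU x Ux; have [n [e [e0 hn]]] := coordinates_nbhd cZ oU Ux.
    by exists n, e; split => // y hy; apply: hn => //; rewrite dZ.
  - move=> m; rewrite /Cs; case: (unpickle m) => [[[n k] q]|].
      by have [] := (mh n).2 _ (BA n k q); rewrite dZ.
    by have [] := smallest_sigma_algebra setT (opens Z).
  - move=> z z' h; apply: hminus_separates => n.
    have Dz x : dom Z x by rewrite dZ.
    apply: (cTh n).2; [exact: (mh n).1|exact: (mh n).1|] => k.
    have hq q : theta n k (hminus S Bs T n p z) < ratR q <->
        theta n k (hminus S Bs T n p z') < ratR q.
      have := h (pickle (n, k, q)); rewrite /Cs pickleK => -[h1 h2].
      split=> lt.
        by have [[_]] := h1 (conj (conj ((mh n).1 _ (Dz z)) lt) (Dz z)).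
      by have [[_]] := h2 (conj (conj ((mh n).1 _ (Dz z')) lt) (Dz z')).
    apply/eqP; rewrite eq_le !leNgt; apply/andP; split; apply/negP => /rat_between[q [q1 q2]].
      by have := (hq q).2 q1; rewrite ltNge (ltW q2).
    by have := (hq q).1 q1; rewrite ltNge (ltW q2).
move=> E [+ _]; rewrite dZ => /sub; apply: smallest_sub.
  exact: smallest_sigma_algebra.
move=> _ [m _ <-]; rewrite /Cs; case: (unpickle m) => [[[n k] q]|].
  by apply: sub_gen_smallest; exists n, (A n k q).
by have [] := smallest_sigma_algebra setT hierarchy_sets.
Qed.

Lemma eq_of_marginals mu nu :
  dom (Cps S Bs p Z fst) mu -> dom (Cps S Bs p Z fst) nu ->
  (forall n, marg (Theta S Bs n p) Z (hminus S Bs T n p) mu =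
             marg (Theta S Bs n p) Z (hminus S Bs T n p) nu) ->
  mu = nu.
Proof.
move=> [pm _ _] [pn _ _] h; apply/funext => k.
(* Were Z empty, the measure [mu k] would give the empty set both mass 1 and mass 0. *)
have [z0] : exists z : car Z, True.
  apply: contrapT => no; have [_ _ m0 m1 _] := pm k.
  have : dom Z = set0 by apply/seteqP; split=> z // _; apply: no; exists z.
  by move=> dZ; move: m1; rewrite dZ m0 => /eqP; rewrite eqe eq_sym oner_eq0.
move=> _; apply: (is_prob_eq (SxTy_coordinates cS cT p) setI_closed_hierarchy_sets _
  (borelsets_hierarchy z0) (pm k) (pn k)).
  by move=> _ [n [E [BE ->]]]; exact: (mh n).2.
move=> _ [n [E [BE ->]]]; have := congr1 (fun m => m k E) (h n).
by rewrite !margE.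
Qed.

End Determination.

(** * Adjoining one type *)

Definition disjoint_sum (X : topologicalType) (E : Type) : Type := (X + E)%type.

Section DisjointSum.
Variables (X : topologicalType) (E : Type).
Local Notation XE := (disjoint_sum X E).

HB.instance Definition _ := gen_eqMixin XE.
HB.instance Definition _ := gen_choiceMixin XE.

(** The disjoint union topology with E discrete, so the part of U in E is unconstrained. *)
Definition sum_open (U : set XE) : Prop := open [set x : X | U (inl x)].

Let sum_openT : sum_open setT.
Proof. exact: openT. Qed.

Let sum_openI (U V : set XE) : sum_open U -> sum_open V -> sum_open (U `&` V).
Proof. exact: openI. Qed.

Let sum_open_bigcup (I : Type) (F : I -> set XE) :
  (forall i, sum_open (F i)) -> sum_open (\bigcup_i F i).
Proof.
move=> h; rewrite /sum_open.
rewrite (_ : mkset _ = \bigcup_i [set x : X | F i (inl x)]); last by apply/seteqP; split.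
by apply: bigcup_open => i _; exact: h.
Qed.

HB.instance Definition _ := isOpenTopological.Build XE sum_openT sum_openI sum_open_bigcup.

(** Distances in X are truncated at 1 and any two distinct points not both in X are at distance 1.
    The truncation saves the triangle inequality through a point of E; radius 1 isolates the points
    of E. *)
Lemma sum_metrizable : metrizable X -> metrizable XE.
Proof.
move=> [d [[d0 dE dC dT] dO]].
pose d' (x y : XE) : R := match x, y with
  | inl a, inl b => Num.min (d a b) 1
  | inr e, inr e' => if `[< e = e' >] then 0 else 1
  | _, _ => 1
  end.
have dxx x : d x x = 0 by apply/dE.
have m0 a b : 0 <= Num.min (d a b) 1 by rewrite le_min d0 ler01.
have m1 a b : Num.min (d a b) 1 <= 1 by rewrite ge_min lexx orbT.
exists d'; split; first split.
- by move=> [a|e] [b|e'] //=; case: asboolP.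
- move=> [a|e] [b|e'] /=; split=> //.
  + case: (leP (d a b) 1) => [_ /dE ->//|_ /eqP]; by rewrite oner_eq0.
  + by move=> [->]; rewrite dxx; case: leP => //; rewrite ltNge ler01.
  + by move=> /eqP; rewrite oner_eq0.
  + by move=> /eqP; rewrite oner_eq0.
  + by case: asboolP => [->//|_ /eqP]; rewrite oner_eq0.
  + by move=> [->]; rewrite asboolT.
- move=> [a|e] [b|e'] //=; first by rewrite dC.
  by congr (if _ then _ else _); apply/asboolP/asboolP.
- move=> [a|e] [b|e'] [c|e''] //=.
  + have := dT a b c; have := d0 a b; have := d0 b c.
    by case: (leP (d a c) 1) => ?; case: (leP (d a b) 1) => ?; case: (leP (d b c) 1) => ?; lra.
  + by have := m0 a b; lra.
  + by have := m1 a c; lra.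
  + by case: asboolP => _; lra.
  + by have := m0 b c; lra.
  + by case: asboolP => _; lra.
  + by case: asboolP => _; lra.
  + by case: asboolP => [->|]; case: asboolP => [->|]; case: asboolP => //; lra.
move=> U; split.
  move=> /dO oU [a|e] Ux.
    have [r r0 hr] := oU a Ux; exists (Num.min r 1); first by rewrite lt_min r0 ltr01.
    move=> [b|e'] /=.
      by case: (leP (d a b) 1) => ?; case: (leP r 1) => ? ?; apply: hr => /=; lra.
    by rewrite lt_min ltxx andbF.
  exists 1 => // -[b|e'] /=; first by rewrite ltxx.
  by case: asboolP => [<-//|_]; rewrite ltxx.
move=> h; apply/dO => a Ua; have [r r0 hr] := h _ Ua; exists r => // b /= ab.
by apply: hr => /=; rewrite gt_min ab.
Qed.

Hypothesis subE : forall e e' : E, e = e'.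

(** Coordinate 0 is the indicator of E. It keeps X and E apart, and [subE] leaves nothing to
    separate inside E. *)
Definition sum_coord (phi : nat -> X -> R) (i : nat) (x : XE) : R :=
  match i, x with
  | 0, inl _ => 0
  | 0, inr _ => 1
  | k.+1, inl a => phi k a
  | _.+1, inr _ => 0
  end.

Lemma sum_coordinates phi : coordinates (topsp X) phi -> coordinates (topsp XE) (sum_coord phi).
Proof.
move=> cX; split; last first.
  move=> [a|e] [b|e'] _ _ h.
  - by congr inl; apply: cX.2 => // k; exact: (h k.+1).
  - by have /eqP := h 0%N; rewrite /= eq_sym oner_eq0.
  - by have /eqP := h 0%N; rewrite /= oner_eq0.
  - by congr inr; exact: subE.
move=> U; split.
  move=> oU; split => // -[a|e] Ux.
    have [n [r [r0 hn]]] := 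
      @coordinates_nbhd (topsp X) phi a [set x : X | U (inl x)] cX oU Ux.
    exists n.+1, (Num.min r 1); split; first by rewrite lt_min r0 ltr01.
    move=> [b|e'] _ h.
      by apply: hn => // k kn; have := h k.+1 kn; rewrite lt_min => /andP[].
    by have := h 0%N (ltn0Sn _); rewrite /= subr0 normr1 lt_min ltxx andbF.
  exists 1%N, 1; split => // -[b|e'] _ h; last by rewrite (subE e' e).
  by have := h 0%N isT; rewrite /= sub0r normrN normr1 ltxx.
move=> [_ h]; apply/(cX.1 _); split => // a Ua.
have [n [r [r0 hn]]] := h _ Ua; exists n, r; split => // b _ hb.
apply: hn => // -[|k] kn /=; first by rewrite subrr normr0.
by apply: hb; exact: ltnW.
Qed.

Lemma borel_map_inl phi : coordinates (topsp X) phi ->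
  borel_map (topsp X) (topsp XE) inl.
Proof.
move=> cX; apply: borel_map_open => // U oU; rewrite setIT.
exact: (borelsets_open cX oU).
Qed.

(** The induction is on B with V quantified inside, because a complement also replaces V by its
    complement. *)
Lemma sum_borelsets phi (B : set X) (V : set E) : coordinates (topsp X) phi ->
  borelsets (topsp X) B ->
  borelsets (topsp XE) [set x : XE | match x with inl a => B a | inr e => V e end].
Proof.
move=> cX BB; have cXE := sum_coordinates cX.
pose F (B : set X) (V : set E) : set XE :=
  [set x : XE | match x with inl a => B a | inr e => V e end].
move: V; rewrite -/(F B _).
apply: (@borelsets_min (topsp X) [set B | forall V, borelsets (topsp XE) (F B V)] _ _ B BB).
  split=> /=.
  - by move=> V; apply: (borelsets_open cXE); change (open (set0 : set X)); exact: open0.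
  - move=> A hA V; have := borelsetsD (hA (~` V)); congr borelsets.
    apply/seteqP; split=> -[a|e] h.
    + by case: h.
    + by case: h => _ h; apply: contrapT.
    + by case: h.
    + by split.
  - move=> A hA V; have := borelsetsU (fun n => hA n V); congr borelsets.
    apply/seteqP; split=> -[a|e] /=.
    + by move=> [n _ Aa]; exists n.
    + by move=> [n _].
    + by move=> [n _ Aa]; exists n.
    + by move=> Ve; exists 0%N.
by move=> U oU V; apply: (borelsets_open cXE).
Qed.

End DisjointSum.

Section Extension.
Variables (S : topologicalType) (Bs : bool -> set (set S)) (phiS : nat -> S -> R).
Hypothesis cS : coordinates (topsp S) phiS.
Hypothesis cBs : forall p, countable (Bs p).
Hypothesis bBs : forall p B, Bs p B -> borelsets (topsp S) B.
Variable T : tstruct S Bs.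
Variable tau : forall p, nat -> Ty S Bs T p -> R.
Hypothesis cT : forall p, coordinates (topsp (Ty S Bs T p)) (@tau p).
Hypothesis hT : is_tstruct S Bs T.
Variable p : bool.
Variable mu : car (Cps S Bs p (SxTy T p) fst).
Hypothesis hmu : dom (Cps S Bs p (SxTy T p) fst) mu.

(* The new types of player q: a single one, with belief mu, when q = p, and
   none otherwise. *)
Definition new_type (q : bool) : Type :=
  {m : car (Cps S Bs q (SxTy T q) fst) | dom (Cps S Bs q (SxTy T q) fst) m /\
    existT (fun q => car (Cps S Bs q (SxTy T q) fst)) q m = existT _ p mu}.

(** The equation of dependent pairs ties m to mu without a cast along q = p; decidable equality on
    [bool] turns it back into an equality of second components. *)
Lemma new_type_unique q (e e' : new_type q) : e = e'.
Proof.
case: e e' => [m [Dm em]] [m' [Dm' em']].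
have mm' : m = m'.
  apply: (Eqdep_dec.inj_pair2_eq_dec bool Bool.bool_dec
    (fun q => car (Cps S Bs q (SxTy T q) fst))).
  by rewrite em em'.
by subst m'; congr exist; exact: Prop_irrelevance.
Qed.

Definition ext_type (q : bool) : topologicalType := disjoint_sum (Ty S Bs T q) (new_type q).

Definition ext_space (q : bool) : Defs.space :=
  prod_space (topsp S) (topsp (ext_type (~~ q))).

Definition ext_incl (q : bool) (z : S * Ty S Bs T (~~ q)) : S * ext_type (~~ q) :=
  (z.1, inl z.2).

Definition old_belief (q : bool) (x : ext_type q) : car (Cps S Bs q (SxTy T q) fst) :=
  match x with inl t => beta S Bs T q t | inr e => sval e end.

(** Every belief, old or new, is pushed forward along the inclusion, so it gives the opponent's new
    types probability 0. *)
Definition extension : tstruct S Bs :=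
  @TStruct S Bs ext_type
    (fun q x => marg (ext_space q) (SxTy T q) (@ext_incl q) (old_belief x)).

Lemma ext_coordinates q : coordinates (topsp (ext_type q)) (sum_coord (@tau q)).
Proof. exact: (sum_coordinates (@new_type_unique q) (cT q)). Qed.

Lemma borel_map_ext_incl q : borel_map (SxTy T q) (ext_space q) (@ext_incl q).
Proof.
apply: (borel_map_pair cS (ext_coordinates (~~ q))).
  exact: (borel_map_fst cS (cT (~~ q))).
exact: (borel_map_comp (borel_map_snd cS (cT (~~ q))) (borel_map_inl _ (cT (~~ q)))).
Qed.

Lemma dom_old_belief q x : dom (Cps S Bs q (SxTy T q) fst) (@old_belief q x).
Proof.
case: x => [t|[m hm]]; last exact: hm.1.
by have [_ h _] := hT q; exact: h.
Qed.

Lemma ext_events q (k : Bidx S Bs q) :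
  borelsets (ext_space q) [set y | dom (ext_space q) y /\ (proj1_sig k : set S) y.1].
Proof.
case: k => [B hB] /=; have := (borel_map_fst cS (ext_coordinates (~~ q))).2 _ (bBs hB).
by congr borelsets; apply/seteqP; split=> y; case.
Qed.

Lemma ext_events_incl q (k : Bidx S Bs q) :
  @ext_incl q @^-1` [set y | dom (ext_space q) y /\ (proj1_sig k : set S) y.1]
    `&` dom (SxTy T q) = [set y | dom (SxTy T q) y /\ (proj1_sig k : set S) y.1].
Proof. by apply/seteqP; split=> z; [move=> [[]]|move=> []]. Qed.

Lemma is_tstruct_extension : is_tstruct S Bs extension.
Proof.
move=> q; have [mT _ _] := hT q; split.
- exact: sum_metrizable.
- move=> x; apply: (marg_cps (borel_map_ext_incl q) _ _ (dom_old_belief x)).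
    by move=> k; exact: ext_events.
  by move=> k; exact: ext_events_incl.
move=> E BE; have [dec decP] := Bidx_enum cBs q.
have mb := borel_map_marg (cT q) (SxTy_coordinates cS cT q)
  (prod_coordinates cS (ext_coordinates (~~ q))) decP (borel_map_beta hT q)
  (borel_map_ext_incl q) (@ext_events q) (@ext_events_incl q).
have := mb.2 E BE; rewrite setIT => BE'.
(* On the old summand the beliefs are images of [beta], Borel by [borel_map_marg]; on the discrete
   new summand every set is allowed. *)
have := sum_borelsets (@new_type_unique q)
  [set e : new_type q | E (beta S Bs extension q (inr e))] (cT q) BE'.
set A := [set x | _]; have -> : A = beta S Bs extension q @^-1` E; last exact.
by apply/seteqP; split=> -[t|e] h; exact: h.
Qed.

Let cX q : coordinates (topsp (Ty S Bs extension q)) (sum_coord (@tau q)).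
Proof. exact: ext_coordinates. Qed.

(** Functoriality of images: pushing forward along the inclusion and then along the extended
    hierarchy map amounts to using the map of T. It serves the old types in the induction below and
    the new type in the theorem. *)
Lemma marg_hminus_extension n q x :
  (forall z, hminus S Bs extension n q (ext_incl z) = hminus S Bs T n q z) ->
  hfull S Bs extension q x n =
  marg (Theta S Bs n q) (SxTy T q) (hminus S Bs T n q) (old_belief x).
Proof.
move=> h; have [mh _] := borel_map_hierarchy cS cBs bBs cX is_tstruct_extension n.
rewrite /hfull [LHS](marg_marg (X := SxTy T q) (Y := ext_space q) _
  (borel_map_ext_incl q).1 (mh q)).
by apply: eq_marg => z _; exact: h.
Qed.

(** The induction runs over both players: agreement of [hminus] at n.+1 needs that of the opponent's
    old types at n, and in turn yields agreement of [hier] at n.+1. *)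
Lemma hier_extension n : (forall q t, hier S Bs extension n q (inl t) = hier S Bs T n q t) /\
  (forall q z, hminus S Bs extension n q (ext_incl z) = hminus S Bs T n q z).
Proof.
elim: n => [|n [IH1 IH2]].
  split=> // q t; exact: (marg_hminus_extension (n := 0) (inl t : ext_type q)).
have h q z : hminus S Bs extension n.+1 q (ext_incl z) = hminus S Bs T n.+1 q z.
  by rewrite /= IH1.
split => // q t.
have := marg_hminus_extension (inl t : ext_type q) (h q).
by rewrite /hfull /= => ->; rewrite IH1.
Qed.

End Extension.

Unset Implicit Arguments.

Theorem theorem2 (S : topologicalType) (Bs : bool -> set (set S))
    (T : tstruct S Bs) :
  setting S Bs ->
  is_tstruct S Bs T ->
  souslin_ts S Bs T ->
  non_redundant S Bs T ->
  terminal S Bs T ->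
  complete_ts S Bs T.
Proof.
move=> [mS sS hB] hT sT nT termT p mu hmu.
have [phiS cS] := topsp_coordinates mS sS.
have cBs q : countable (Bs q) by have [] := hB q.
have bBs q B : Bs q B -> borelsets (topsp S) B by move=> /((hB q).2 B)[].
have htau q : {th | coordinates (topsp (Ty S Bs T q)) th}.
  by apply: cid; have [mT _ _] := hT q; exact: topsp_coordinates mT (sT q).
pose tau q := projT1 (htau q).
have cT q : coordinates (topsp (Ty S Bs T q)) (tau q) := projT2 (htau q).
have hext := is_tstruct_extension cS cBs bBs cT hT mu.
pose e : new_type mu p := exist _ mu (conj hmu erefl).
have [t ht] := termT _ hext p (inr e : ext_type mu p).
exists t; apply/esym.
apply: (eq_of_marginals cS cBs bBs cT hT sS sT nT hmu).
  by have [_ h _] := hT p; exact: h.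
(* On the old space the extended hierarchy maps are those of T, so the level-n belief of e is the
   marginal of mu under the map of T itself. *)
move=> n; have [_ hm] := hier_extension cS cBs bBs cT hT mu n.
have := congr1 (fun h => h n) ht.
by rewrite (marg_hminus_extension cS cBs bBs cT hT (inr e : ext_type mu p) (hm p)).
Qed.
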